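(* Let $\mathcal{H}:\mathbb{R}^n\rightrightarrows\mathbb{R}^n$ be nonempty-valued, convex-valued, graph-closed and locally bounded. Let $\mathcal{A}\subset\mathbb{R}^n$ be closed, and let $\Psi:\mathbb{R}^n\to\mathbb{R}$ be coercive, locally Lipschitz continuous, and a Lyapunov function with stable set $\mathcal{A}$ for the differential inclusion $\frac{\mathrm{d}\bar x}{\mathrm{d}t}\in-\mathrm{conv}(\mathcal{H}(\bar x))$. Assume that $\{\Psi(x):x\in\mathcal{A}\}$ is a finite subset of $\mathbb{R}$. Let $\mathcal{U}_1,\dots,\mathcal{U}_N:\mathbb{R}^n\rightrightarrows\mathbb{R}^n$ be locally bounded and graph-closed, with $$\mathrm{conv}\Big(\frac1N\sum_{i=1}^N\mathcal{U}_i(x)\Big)\subseteq\mathcal{H}(x)\quad\text{for all }x\in\mathbb{R}^n,$$ and let $p:\mathbb{R}^n\to[0,\infty)$ be locally bounded. Let $\mathcal{X}_0\subset\mathbb{R}^n$ be compact. Then there exists $\alpha_{ub}>0$ such that for every $\varepsilon>0$ there exists $\alpha>0$ with the following property. Let $\{\eta_k\}_{k\ge0}$ be any positive sequence with $\sum_k\eta_k=\infty$, with $\eta_{j_1}=\eta_{j_2}$ whenever $\lfloor j_1/N\rfloor=\lfloor j_2/N\rfloor$, and with $\sup_k\eta_k\le\alpha_{ub}$, $\limsup_k\eta_k\le\alpha$. Let $\{i_k\}$ be any sequence in $[N]$ with $\{i_k:jN\le k<(j+1)N\}=[N]$ for every integer $j\ge0$. Then every sequence $\{x_k\}$ with $x_0\in\mathcal{X}_0$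 and $$x_{k+1}\in x_k-\eta_k\,\mathcal{U}_{i_k}^{\,p(x_k)\eta_k}(x_k),\qquad k\ge0,$$ satisfies $$\limsup_{k\to\infty}\mathrm{dist}(x_k,\mathcal{A})\le\varepsilon,\qquad\limsup_{k\to\infty}\mathrm{dist}\left(\Psi(x_k),\{\Psi(x):x\in\mathcal{A}\}\right)\le\varepsilon.$$
   Context: $[N]=\{1,\dots,N\}$. A set-valued map $\mathcal{H}$ is graph-closed if $\{(x,z):z\in\mathcal{H}(x)\}$ is closed; locally bounded if every $x$ has a neighborhood $V_x$ with $\bigcup_{y\in V_x}\mathcal{H}(y)$ bounded. $\mathbb{B}_\delta(x)$ is the closed Euclidean ball. For a set-valued map $\mathcal{U}$ and $\delta\ge0$, $\mathcal{U}^\delta(x):=\bigcup_{y\in\mathbb{B}_\delta(x)}(\mathcal{U}(y)+\mathbb{B}_\delta(0))$. Coercive: $\Psi(x)\to\infty$ as $\|x\|\to\infty$. A trajectory of $\frac{\mathrm{d}x}{\mathrm{d}t}\in-\mathcal{H}(x)$ is an absolutely continuous $\gamma:[0,\infty)\to\mathbb{R}^n$ with $\dot\gamma(t)\in-\mathcal{H}(\gamma(t))$ for almost every $t\ge0$. A continuous $\Psi$ is a Lyapunov function for this inclusion with closed stable set $\mathcal{A}$ if for every trajectory $\gamma$: if $\gamma(0)\notin\mathcal{A}$ then $\Psi(\gamma(t))<\Psi(\gamma(0))$ for all $t>0$; if $\gamma(0)\in\mathcal{A}$ then $\Psi(\gamma(t))\le\Psi(\gamma(0))$ for all $t\ge0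$.
   Formalization: The formal theorem also assumes that a trajectory of the inclusion on [0,∞) starts at every point; without this the claim fails: H(x)=U_1(x)={-(1+x²)}, n=N=1, p=0, A={0}, Ψ=x², X_0={0} has no trajectory, so Ψ is vacuously Lyapunov, yet the iterates diverge. *)

(* Defs.v *)
From HB Require Import structures.
From mathcomp Require Export all_boot all_order all_algebra.
From mathcomp Require Export all_classical all_reals all_analysis.
Export Order.TTheory GRing.Theory Num.Theory.
Export numFieldNormedType.Exports.

Set Implicit Arguments.
Unset Strict Implicit.
Unset Printing Implicit Defensive.

Local Open Scope classical_set_scope.
Local Open Scope ring_scope.

Section Euclidean.
Context {R : realType} {n : nat}.
Implicit Types (x : 'rV[R]_n) (A : set 'rV[R]_n).

(* The library norm [`|x|] on ['rV_n] is the sup norm.  It generates the same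
   topology, bounded sets and Lipschitz maps as [enorm], so the library notions
   are used for those; metric quantities (balls, distances, path length) use
   [enorm]. *)
Definition enorm x : R := Num.sqrt (\sum_(j < n) x ord0 j ^+ 2).

Definition eball x (r : R) : set 'rV[R]_n := [set y | enorm (y - x) <= r].

(* Equals [+oo] when [A] is empty. *)
Definition edist_to x A : \bar R :=
  ereal_inf [set (enorm (x - a))%:E | a in A].

Definition conv_hull A : set 'rV[R]_n :=
  smallest (@convex_set R 'rV[R]_n) A.

Definition coercive (Psi : 'rV[R]_n -> R) :=
  forall M : R, exists r : R, forall x, r <= enorm x -> M <= Psi x.

Definition locally_lipschitz (Psi : 'rV[R]_n -> R) :=
  forall x, exists2 V, nbhs x V & [lipschitz Psi z | z in V].

Definition fun_locally_bounded (p : 'rV[R]_n -> R) :=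
  forall x, exists2 V, nbhs x V & bounded_set (p @` V).

End Euclidean.

Section SetValuedMaps.
Context {R : realType} {n : nat}.
Implicit Types (H U : 'rV[R]_n -> set 'rV[R]_n) (x : 'rV[R]_n).

Definition graph_closed H := closed [set xz | H xz.1 xz.2].

Definition locally_bounded H :=
  forall x : 'rV[R]_n,
    exists2 V, nbhs x V & bounded_set (\bigcup_(y in V) H y).

Definition expansion (d : R) U : 'rV[R]_n -> set 'rV[R]_n := fun x =>
  \bigcup_(y in eball x d) [set u + b | u in U y & b in eball 0 d].

(* [N^-1 (U_1 x + ... + U_N x)], a Minkowski sum. *)
Definition average (N : nat) (U : 'I_N -> 'rV[R]_n -> set 'rV[R]_n) :
    'rV[R]_n -> set 'rV[R]_n := fun x =>
  [set N%:R^-1 *: (\sum_(i < N) u i) |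
    u in [set u : 'I_N -> 'rV[R]_n | forall i, U i x (u i)]].

End SetValuedMaps.

Section DifferentialInclusions.
Context {R : realType} {n : nat}.
Implicit Types (H : 'rV[R]_n -> set 'rV[R]_n) (gamma : R -> 'rV[R]_n).

(* Absolute continuity on [0, oo) means, as usual, absolute continuity on every
   [0, T].  Paths are total functions on [R]; their values at negative times
   are irrelevant. *)
Definition absolutely_continuous gamma :=
  forall T e : R, 0 < e -> exists2 d : R, 0 < d &
    forall (m : nat) (a b : 'I_m -> R),
      (forall i, [/\ 0 <= a i, a i <= b i & b i <= T]) ->
      (forall i j, i != j -> b i <= a j \/ b j <= a i) ->
      \sum_(i < m) (b i - a i) < d ->
      \sum_(i < m) enorm (gamma (b i) - gamma (a i)) < e.

(* Trajectories of [dx/dt \in - H x]. *)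
Definition trajectory H gamma :=
  absolutely_continuous gamma /\
  {ae lebesgue_measure, forall t : R, 0 <= t ->
    derivable gamma t 1 /\ H (gamma t) (- derive1 gamma t)}.

Definition lyapunov H (Psi : 'rV[R]_n -> R) (A : set 'rV[R]_n) :=
  [/\ continuous Psi, closed A &
   forall gamma, trajectory H gamma ->
     (~ A (gamma 0) -> forall t : R, 0 < t -> Psi (gamma t) < Psi (gamma 0)) /\
     (A (gamma 0) -> forall t : R, 0 <= t -> Psi (gamma t) <= Psi (gamma 0))].

(* Trajectories live on all of [0, oo), so [lyapunov] says nothing about
   solutions that blow up in finite time: on the line, [H x = {- (1 + x^2)}]
   has no trajectory at all and every continuous [Psi] is vacuously a Lyapunov
   function for it. *)
Definition solvable_everywhere H :=
  forall x0, exists2 gamma, trajectory H gamma & gamma 0 = x0.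

End DifferentialInclusions.

(* Main.v *)
Require Import Defs.
From HB Require Import structures.
From mathcomp Require Import ring lra.

Set Implicit Arguments.
Unset Strict Implicit.
Unset Printing Implicit Defensive.

Local Open Scope classical_set_scope.
Local Open Scope ring_scope.

(** Why the theorem is true. The step size is constant during one pass over the
    [N] components, so the points [z_j = x_(jN)] satisfy
    [z_(j+1) = z_j - h_j v_j] with [h_j = N eta_(jN)], where [v_j] is, up to an
    error of order [h_j], an average of values of the [U_i] at points within
    [O(h_j)] of [z_j] ([batch_step]). Since closed graph and local boundedness make
    the [U_i] upper semicontinuous, [v_j] is close to [H z_j] when [h_j] is small
    ([batch_velocity_consistent]). What remains is a statement on Euler chains for
    the differential inclusion, perturbed in this consistent way.

    Euler chains that stay in a compact set have trajectories as limits when the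
    steps go to zero ([euler_limit]). The chains are almost equi-Lipschitz, so a
    pointwise limit along an ultrafilter is enough and is a Lipschitz curve. Such a
    curve is differentiable almost everywhere ([lipschitz_ae_derivable]). Its
    difference quotients on a short interval are limits of averages of velocities
    close to the closed convex set [H (g t)] ([euler_mean]), hence its derivative
    lies in [- H (g t)]. The limit exists on a bounded interval only; solvability of
    the inclusion continues it to a trajectory ([concat_trajectory]), to which the
    Lyapunov hypothesis applies.

    By contradiction this limit theorem turns the Lyapunov property into two
    uniform facts for small steps and bounded time: [Psi] increases by at most any
    prescribed [d] ([euler_lyapunov_le]), and it drops by a fixed amount when the
    chain starts at a fixed distance from [A] and runs for a fixed time
    ([euler_lyapunov_lt]). Hence no chain climbs through a band of levels without
    values of [Psi] on [A] ([euler_trap]). A band above [Psi] on [A] and on [X0]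
    keeps all iterates in one compact sublevel set; this fixes [alpha_ub]. As
    [Psi @` A] is finite, it has gaps. Away from it [Psi] keeps dropping, so the
    chain comes close to some critical level infinitely often, and the bands just
    above and just below that level then confine [Psi] to a window around it. If
    the window is narrower than the drop guaranteed at distance [eps] from [A], the
    chain can no longer be at that distance ([euler_asymptotics]). *)

(** * Lipschitz functions on the line are differentiable almost everywhere *)

Section LipschitzDerivable.
Context {R : realType}.
Local Notation mu := (@lebesgue_measure R).

Lemma stieltjes_itv (F : cumulative R R) (a b : R) : a <= b ->
  lebesgue_stieltjes_measure F `]a, b]%classic = (F b - F a)%:E.
Proof.
move=> ab; rewrite /lebesgue_stieltjes_measure /measure_extension.
by rewrite measurable_mu_extE/= ?wlength_itv_bnd//; exact: is_ocitv.
Qed.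

Section SplitIdentity.
Variables F G : cumulative R R.
Hypothesis FGid : forall x, F x + G x = x.

Let lebesgue_sum A : measurable A ->
  mu A = (lebesgue_stieltjes_measure F A + lebesgue_stieltjes_measure G A)%E.
Proof.
pose sum_measure :=
  measure_add (lebesgue_stieltjes_measure F) (lebesgue_stieltjes_measure G).
move=> mA; rewrite -(measure_addE (lebesgue_stieltjes_measure F)).
move: A mA; apply: (@lebesgue_measure_unique R sum_measure) => X [[a b] _ <-] /=.
rewrite [RHS]measure_addE /lebesgue_measure.
have [ab|ba] := leP a b; last first.
  by rewrite set_itv_ge ?bnd_simp -?leNgt ?ltW// !measure0 adde0.
transitivity ((F b - F a)%:E + (G b - G a)%:E)%E; last first.
  by rewrite -!stieltjes_itv.
by rewrite stieltjes_itv// -EFinD; congr EFin; move: (FGid a) (FGid b) => /=; lra.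
Qed.

Let stieltjes_le A : measurable A -> (lebesgue_stieltjes_measure F A <= mu A)%E.
Proof. by move=> mA; rewrite lebesgue_sum// leeDl. Qed.

(** The Stieltjes measure of [F] is dominated by Lebesgue measure, because adding
    that of [G] gives Lebesgue measure. Its Radon-Nikodym density [f] turns [F] into
    an integral, differentiable at the Lebesgue points of [f]. Restricting to a
    bounded interval makes the measure finite. *)
Lemma cumulative_ae_derivable_itv (M : R) :
  {ae mu, forall x, - M < x < M -> derivable F x 1}.
Proof.
pose D : set (measurableTypeR R) := `]-M, M]%classic.
have mD : measurable D by exact: measurable_itv.
have Doo : (lebesgue_stieltjes_measure F D < +oo)%E.
  apply: le_lt_trans (stieltjes_le mD) _.
  by rewrite /D lebesgue_measure_itv /=; case: ifP => // _; rewrite -EFinB ltry.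
pose nu : {finite_measure set (measurableTypeR R) -> \bar R} := mfrestr mD Doo.
have nu_mu : nu `<< mu.
  apply/null_content_dominatesP => A mA muA0; apply/eqP.
  rewrite eq_le measure_ge0 andbT /nu /= /mfrestr /mrestr.
  have mAD : measurable (A `&` D) by exact: measurableI.
  apply: le_trans (stieltjes_le mAD) _.
  by rewrite -muA0 le_measure// inE.
have [g [g0 gfin gint nuE]] := radon_nikodym_sigma_finite nu_mu.
pose f := fine \o g.
have gE : g = EFin \o f by apply/funext => x /=; rewrite /f /= fineK.
have fint : mu.-integrable setT (EFin \o f) by rewrite -gE.
have floc : locally_integrable setT f.
  by apply: open_integrable_locally => //; exact: openT.
have := lebesgue_differentiation floc.
apply: filterS; first exact: (ae_filter_ringOfSetsType mu).
move=> x fx /andP[xM1 xM2].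
have xM : (BRight (- M) < BRight x)%O by rewrite bnd_simp.
have [] := @FTC1_lebesgue_pt _ f (BRight (- M)) x M xM2 _ xM fx.
  exact: integrableS fint.
move=> dF _.
have FE : \forall y \near x, F y =
    F (- M) + (\int[mu]_(t in [set` Interval (BRight (- M)) (BRight y)]) f t)%R.
  have : \forall y \near x, y \in `]-M, M[.
    by apply: near_in_itvoo; rewrite in_itv/= xM1 xM2.
  apply: filterS => y; rewrite in_itv /= => /andP[y1 y2].
  have my : measurable (`]-M, y]%classic : set (measurableTypeR R)).
    exact: measurable_itv.
  have -> : Rintegral mu [set` `]-M, y]] f = fine (nu `]-M, y]%classic).
    by rewrite nuE// /Rintegral gE.
  rewrite /nu /= /mfrestr /mrestr.
  rewrite setIidl; last first.
    move=> t /=; rewrite /D /= !in_itv/= => /andP[-> ty] /=.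
    exact: le_trans ty (ltW y2).
  by rewrite stieltjes_itv ?ltW//= addrC subrK.
apply: near_eq_derivable (_ : derivable (fun y => F (- M) + _) x 1).
  by apply: filterS FE => y ->.
by apply: derivableD.
Qed.

End SplitIdentity.

Lemma cumulative_ae_derivable (F G : cumulative R R) :
  (forall x, F x + G x = x) -> {ae mu, forall x, derivable F x 1}.
Proof.
move=> FG.
have : {ae mu, forall x, forall m : nat, - m%:R < x < m%:R -> derivable F x 1}.
  apply/ae_foralln => m; exact: cumulative_ae_derivable_itv FG _.
apply: filterS; first exact: (ae_filter_ringOfSetsType mu).
move=> x /(_ (Num.bound `|x|)); apply; rewrite -ltr_norml.
exact: archi_boundP.
Qed.

(** For [c] above the Lipschitz constant, [(x + f x / c) / 2] and
    [(x - f x / c) / 2] are nondecreasing and add up to the identity. *)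
Lemma lipschitz_ae_derivable (f : R -> R) (L : R) :
  (forall x y, `|f x - f y| <= L * `|x - y|) ->
  {ae mu, forall x, derivable f x 1}.
Proof.
move=> fL; pose c := `|L| + 1.
have c0 : 0 < c by rewrite ltr_wpDl.
have fc x y : `|f x - f y| <= c * `|x - y|.
  by apply: le_trans (fL x y) _; rewrite ler_wpM2r// /c ler_wpDr// ler_norm.
have fcont : continuous f.
  move=> x; apply/cvgrPdist_le => e e0; near=> y.
  apply: le_trans (fc x y) _; rewrite -ler_pdivlMl//.
  near: y; apply: cvgr_dist_le => //; rewrite mulr_gt0 ?invr_gt0//.
pose G (s x : R) := (x + s * (c^-1 * f x)) / 2.
have Gnd s : `|s| <= 1 -> nondecreasing (G s).
  move=> s1 x y xy; rewrite /G ler_pM2r ?invr_gt0//.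
  suff : `|s * (c^-1 * (f x - f y))| <= y - x by rewrite ler_norml; nra.
  rewrite !normrM (gtr0_norm (_ : 0 < c^-1)) ?invr_gt0//.
  have := fc x y; rewrite distrC (distrC x) (ger0_norm (_ : 0 <= y - x)) ?subr_ge0//.
  rewrite -ler_pdivrMl// => /(le_trans _); apply.
  by rewrite ler_piMl// mulr_ge0// invr_ge0 ltW.
have Grc s : right_continuous (G s).
  apply: right_continuousW => x; apply: cvgMl; apply: cvgD; first exact: cvg_id.
  by apply: cvgMr; apply: cvgMr; exact: fcont.
have norm1 : `|1 : R| <= 1 by rewrite normr1.
have normN1 : `|- 1 : R| <= 1 by rewrite normrN normr1.
pose F1 : cumulative R R := HB.pack (G 1)
  (isCumulative.Build R _ R (G 1) (Gnd _ norm1) (Grc _)).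
pose F2 : cumulative R R := HB.pack (G (- 1))
  (isCumulative.Build R _ R (G (- 1)) (Gnd _ normN1) (Grc _)).
have FG x : F1 x + F2 x = x by rewrite /= /G; lra.
have := cumulative_ae_derivable FG.
apply: filterS; first exact: (ae_filter_ringOfSetsType mu).
move=> x dG.
have -> : f = (fun y => c * (2 * G 1 y - y)).
  by apply/funext => y; rewrite /G; field; rewrite gt_eqF.
apply: derivableZ; apply: derivableB; last exact: derivable_id.
exact: derivableZ.
Unshelve. all: by end_near. Qed.

End LipschitzDerivable.

(** * The Euclidean norm and absolutely continuous curves *)

Section Curves.
Context {R : realType} {n : nat}.
Local Notation V := 'rV[R]_n.
Local Notation mu := (@lebesgue_measure R).
Implicit Types (g : R -> V) (H : V -> set V).

Lemma coord_le_norm (x : V) (j : 'I_n) : `|x ord0 j| <= `|x|.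
Proof.
rewrite [leRHS]/Num.Def.normr/= mx_normrE.
exact: (le_bigmax _ (fun ij : 'I_1 * 'I_n => `|x ij.1 ij.2|) (ord0, j)).
Qed.

Lemma norm_le_enorm (x : V) : `|x| <= enorm x.
Proof.
rewrite [leLHS]/Num.Def.normr/= mx_normrE (bigmax_le _ (sqrtr_ge0 _))//.
move=> -[i j] _ /=; rewrite ord1 -sqrtr_sqr ler_wsqrtr//.
by rewrite (bigD1 j)//= lerDl sumr_ge0// => k _; rewrite sqr_ge0.
Qed.

Lemma enorm_le_norm (x : V) : enorm x <= n%:R * `|x|.
Proof.
rewrite -(ler_pXn2r (_ : (0 < 2)%N)) ?nnegrE ?sqrtr_ge0 ?mulr_ge0//.
rewrite sqr_sqrtr; last by rewrite sumr_ge0// => k _; rewrite sqr_ge0.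
apply: (@le_trans _ _ (\sum_(j < n) `|x| ^+ 2)).
  apply: ler_sum => j _; rewrite -real_normK ?num_real//.
  by rewrite ler_pXn2r ?nnegrE// coord_le_norm.
rewrite sumr_const card_ord -[leLHS]mulr_natl exprMn ler_wpM2r ?sqr_ge0//.
by rewrite -natrX ler_nat expnS expn1; case: (n) => // m; rewrite leq_pmulr.
Qed.

Lemma conv_hull_id (A : set V) : @convex_set R V A -> conv_hull A = A.
Proof.
move=> Acvx; apply/seteqP; split; last exact: sub_smallest.
exact: smallest_sub.
Qed.

(** For the equivalent sup norm the triangle inequality is available; sums and
    concatenations of curves are treated through this form. *)
Lemma absolutely_continuousP g :
  absolutely_continuous g <->
  forall T e : R, 0 < e -> exists2 d : R, 0 < d &
    forall (m : nat) (a b : 'I_m -> R),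
      (forall i, [/\ 0 <= a i, a i <= b i & b i <= T]) ->
      (forall i j, i != j -> b i <= a j \/ b j <= a i) ->
      \sum_(i < m) (b i - a i) < d ->
      \sum_(i < m) `|g (b i) - g (a i)| < e.
Proof.
split=> gac T e e0.
  have [d d0 gd] := gac T e e0; exists d => // m a b ab dis abd.
  apply: le_lt_trans (gd m a b ab dis abd).
  by apply: ler_sum => i _; exact: norm_le_enorm.
have [|d d0 gd] := gac T (e / n.+1%:R); first by rewrite divr_gt0.
exists d => // m a b ab dis abd.
apply: (@le_lt_trans _ _ (n.+1%:R * \sum_(i < m) `|g (b i) - g (a i)|)).
  rewrite mulr_sumr; apply: ler_sum => i _.
  apply: le_trans (enorm_le_norm _) _.
  by rewrite ler_wpM2r// ler_nat.
by rewrite mulrC -ltr_pdivlMr//; exact: gd.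
Qed.

Lemma lipschitz_absolutely_continuous g (L : R) :
  (forall s t, `|g s - g t| <= L * `|s - t|) -> absolutely_continuous g.
Proof.
move=> gL; apply/absolutely_continuousP => T e e0.
exists (e / (`|L| + 1)); first by rewrite divr_gt0// ltr_wpDl.
move=> m a b ab _; rewrite ltr_pdivlMr ?ltr_wpDl//; apply: le_lt_trans.
rewrite mulr_suml; apply: ler_sum => i _; have [_ abi _] := ab i.
apply: le_trans (gL _ _) _; rewrite ger0_norm ?subr_ge0// mulrC.
by rewrite ler_wpM2l ?subr_ge0// ler_wpDr// ler_norm.
Qed.

Lemma absolutely_continuousD g1 g2 :
  absolutely_continuous g1 -> absolutely_continuous g2 ->
  absolutely_continuous (fun t => g1 t + g2 t).
Proof.
move=> /absolutely_continuousP g1ac /absolutely_continuousP g2ac.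
apply/absolutely_continuousP => T e e0.
have e20 : 0 < e / 2 by rewrite divr_gt0.
have [d1 d10 g1d] := g1ac T _ e20; have [d2 d20 g2d] := g2ac T _ e20.
exists (Num.min d1 d2); first by rewrite lt_min d10.
move=> m a b ab dis; rewrite lt_min => /andP[abd1 abd2].
apply: (@le_lt_trans _ _ (\sum_(i < m) `|g1 (b i) - g1 (a i)| +
                          \sum_(i < m) `|g2 (b i) - g2 (a i)|)).
  rewrite -big_split /=; apply: ler_sum => i _.
  by rewrite opprD addrACA ler_normD.
by rewrite [ltRHS]splitr ltrD// ?g1d ?g2d.
Qed.

Lemma absolutely_continuous_comp g (f : R -> R) :
  (forall t, 0 <= t -> 0 <= f t) ->
  (forall s t, s <= t -> 0 <= f t - f s <= t - s) ->
  absolutely_continuous g -> absolutely_continuous (g \o f).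
Proof.
move=> f0 fl /absolutely_continuousP gac.
apply/absolutely_continuousP => T e e0; have [d d0 gd] := gac (f T) e e0.
have fnd s t : s <= t -> f s <= f t by move=> /fl/andP[]; rewrite subr_ge0.
exists d => // m a b ab dis abd; apply: (gd m (f \o a) (f \o b)) => /=.
- by move=> i; have [a0 abi bT] := ab i; split; [exact: f0|exact: fnd|exact: fnd].
- by move=> i j /dis[/fnd|/fnd]; [left|right].
- apply: le_lt_trans abd; apply: ler_sum => i _; have [_ abi _] := ab i.
  by have /andP[] := fl _ _ abi.
Qed.

Lemma absolutely_continuous_eq g1 g2 :
  (forall t, 0 <= t -> g1 t = g2 t) ->
  absolutely_continuous g1 -> absolutely_continuous g2.
Proof.
move=> g12 gac T e e0; have [d d0 gd] := gac T e e0; exists d => // m a b ab dis.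
move=> /(gd m a b ab dis); under eq_bigr => i _.
  by have [a0 abi _] := ab i; rewrite !g12//; [over|exact: le_trans a0 abi].
done.
Qed.

(** ** Concatenation *)

Definition concat (T : R) g1 g2 := fun t => if t <= T then g1 t else g2 (t - T).

Lemma absolutely_continuous_concat (T : R) g1 g2 : 0 <= T -> g2 0 = g1 T ->
  absolutely_continuous g1 -> absolutely_continuous g2 ->
  absolutely_continuous (concat T g1 g2).
Proof.
move=> T0 g12 g1ac g2ac.
(* For [t >= 0] the concatenation is a sum of curves with clamped time. *)
apply: (@absolutely_continuous_eq (fun t => (g1 \o Num.min T) t +
    ((g2 \o (fun t => Num.max 0 (t - T))) t + cst (- g1 T) t))).
  move=> t t0; rewrite /concat /comp /cst; have [tT|Tt] := leP t T.
    by rewrite max_l ?subr_le0// g12 subrr addr0.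
  by rewrite max_r ?subr_ge0 ?ltW// addrCA subrr addr0.
apply: absolutely_continuousD.
  apply: absolutely_continuous_comp => //.
  - by move=> t t0; rewrite le_min T0.
  - by move=> s t st; rewrite !minEle; do 2 case: ifPn; rewrite -?ltNge; lra.
apply: absolutely_continuousD.
  apply: absolutely_continuous_comp => //.
  - by move=> t t0; rewrite le_max lexx.
  - by move=> s t st; rewrite !maxEle; do 2 case: ifPn; rewrite -?ltNge; lra.
apply: (@lipschitz_absolutely_continuous _ 0) => s t.
by rewrite subrr normr0 mul0r.
Qed.

(** Lebesgue measure is translation invariant since it is determined by the lengths
    of intervals. *)
Lemma negligible_shift (T : R) (N : set R) :
  mu.-negligible N -> mu.-negligible [set t | N (t - T)].
Proof.
pose f : measurableTypeR R -> measurableTypeR R := fun t => t - T.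
have mf : measurable_fun setT f.
  apply: measurable_realfun.continuous_measurable_fun => t.
  by apply: cvgB; [exact: cvg_id|exact: cvg_cst].
have fmu B : measurable B -> mu B = pushforward mu f B.
  apply: (@lebesgue_measure_unique R (pushforward mu f)) => X [[a b] _ <-] /=.
  rewrite /pushforward (_ : f @^-1` _ = `]a + T, b + T]%classic); last first.
    by apply/seteqP; split => t; rewrite /f /= !in_itv/= ltrBrDr lerBlDr.
  rewrite !lebesgue_measure_itv /= !lte_fin ltrD2r -!EFinB.
  by congr (if _ then _%:E else _); ring.
move=> [B [mB B0 NB]]; exists (f @^-1` B); split.
- by rewrite -[X in measurable X]setTI; apply: mf.
- by rewrite -[LHS]/(pushforward mu f B) -fmu.
- by move=> t Nt; exact: NB.
Qed.

(** The two times [0] and [T], at which the concatenation need not be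
    differentiable, form a null set. *)
Lemma concat_trajectory H (T : R) g1 g2 : 0 <= T -> g2 0 = g1 T ->
  absolutely_continuous g1 ->
  {ae mu, forall t, 0 < t < T -> derivable g1 t 1 /\ H (g1 t) (- derive1 g1 t)} ->
  trajectory H g2 -> trajectory H (concat T g1 g2).
Proof.
move=> T0 g12 g1ac g1H [g2ac g2H]; split.
  exact: absolutely_continuous_concat.
have ae_neq (c : R) : {ae mu, forall t, t != c}.
  exists [set c]; split.
  - exact: measurable_set1.
  - exact: lebesgue_measure_set1.
  - by move=> t /= /negP; rewrite negbK => /eqP.
have g2HT : {ae mu, forall t, T <= t ->
    derivable g2 (t - T) 1 /\ H (g2 (t - T)) (- derive1 g2 (t - T))}.
  apply: negligibleS (negligible_shift T g2H) => t /= tH /(_ _) tH'.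
  by apply: tH => Tt; apply: tH'; rewrite subr_ge0.
have aeF := ae_filter_ringOfSetsType mu.
apply: filterS (filterI (filterI g1H g2HT) (filterI (ae_neq 0) (ae_neq T))).
move=> t [[t1 t2] [tn0 tnT]] t0.
have {tn0}t0 : 0 < t by rewrite lt_neqAle eq_sym tn0.
have [tT|Tt] := ltP t T.
  have [dg1 Hg1] := t1 (introT andP (conj t0 tT)).
  have g1E : {near t, g1 =1 concat T g1 g2}.
    have : \forall s \near t, s < T by exact: lt_nbhsl.
    by apply: filterS => s sT; rewrite /concat ltW.
  split; first exact: near_eq_derivable g1E dg1.
  rewrite /concat ltW// derive1E.
  by rewrite -(near_eq_derive _ g1E) -derive1E.
have {tnT Tt}Tt : T < t by rewrite lt_neqAle eq_sym tnT.
have [dg2 Hg2] := t2 (ltW Tt).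
pose g2T := g2 \o (fun s => s - T).
have g2E : {near t, g2T =1 concat T g1 g2}.
  have : \forall s \near t, T < s by exact: lt_nbhsr.
  by apply: filterS => s sT; rewrite /concat leNgt sT.
have g2TE : (fun h : R => h^-1 *: ((g2T \o shift t) (h *: 1) - g2T t)) =
            (fun h : R => h^-1 *: ((g2 \o shift (t - T)) (h *: 1) - g2 (t - T))).
  by apply/funext => h; rewrite /g2T /= addrA.
split; first by apply: near_eq_derivable g2E _; rewrite /derivable g2TE.
rewrite /concat leNgt Tt /= derive1E -(near_eq_derive _ g2E).
by rewrite /derive g2TE -/(derive _ _ _) -derive1E.
Qed.

End Curves.

(** * Euler chains *)

Section EulerChains.
Context {R : realType} {n : nat}.
Local Notation V := 'rV[R]_n.
Implicit Types (H : V -> set V) (E : R -> V -> set V) (K S : set V).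
Implicit Types (h : nat -> R) (z : nat -> V).

(** [E e y] is the set of velocities that a discretization with step [e] may use at
    [y]. Consistency asks that these velocities approach [H x], uniformly as [y]
    tends to [x] and [e] to [0]; it is what survives of the closed graph of [H]
    when the values are perturbed. *)
Definition consistent H E := forall x (d : R), 0 < d ->
  \forall y \near x & e \near 0^'+,
    forall v, E e y v -> exists2 w, H x w & `|v - w| <= d.

Definition euler_step E h z (j : nat) :=
  exists2 v, E (h j) (z j) v & z j.+1 = z j - h j *: v.

Definition euler_chain E K (e : R) h z (b : nat) := forall j, (j < b)%N ->
  [/\ 0 < h j, h j <= e, K (z j) & euler_step E h z j].

Definition elapsed h (b : nat) : R := \sum_(i < b) h i.

Lemma elapsed0 h : elapsed h 0 = 0.
Proof. by rewrite /elapsed big_ord0. Qed.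

Lemma elapsedS h b : elapsed h b.+1 = elapsed h b + h b.
Proof. by rewrite /elapsed big_ord_recr. Qed.

Lemma elapsed_homo h b i j : (forall k, (k < b)%N -> 0 < h k) ->
  (i <= j)%N -> (j <= b)%N -> elapsed h i <= elapsed h j.
Proof.
move=> h0 /subnK <-; elim: (j - i)%N => // m IH mb.
rewrite addSn elapsedS (le_trans (IH (ltnW mb)))// lerDl ltW// h0//.
Qed.

Lemma convex_setP S (x y : V) (a b : R) : @convex_set R V S ->
  S x -> S y -> 0 <= a -> 0 <= b -> a + b = 1 -> S (a *: x + b *: y).
Proof.
move=> Scvx Sx Sy a0 b0 ab1.
have a1 : a <= 1 by rewrite -ab1 lerDl.
have := Scvx x y (Itv01 a0 a1); rewrite !inE => /(_ Sx Sy).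
by rewrite /conv /= /unstable.onem -ab1 addrAC subrr add0r.
Qed.

(** If each velocity used is [d]-close to a convex set, then so is their average
    weighted by the step sizes. With [S = [set 0]] this bounds the displacement of
    the chain by the elapsed time. *)
Lemma euler_mean S (d : R) h z i j :
  @convex_set R V S -> S !=set0 -> (i <= j)%N ->
  (forall k, (i <= k < j)%N -> 0 < h k) ->
  (forall k, (i <= k < j)%N ->
    exists2 v, z k.+1 = z k - h k *: v & exists2 w, S w & `|v - w| <= d) ->
  exists2 w, S w & `|z i - z j - (elapsed h j - elapsed h i) *: w| <=
                   d * (elapsed h j - elapsed h i).
Proof.
move=> Scvx [w0 Sw0] /subnK <-; elim: (j - i)%N => [|m IH] h0 zv.
  by exists w0; rewrite // add0n !subrr scale0r subrr normr0 mulr0.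
have [||w1 Sw1 w1P] := IH.
- by move=> k /andP[ik km]; apply: h0; rewrite ik addSn ltnS ltnW.
- by move=> k /andP[ik km]; apply: zv; rewrite ik addSn ltnS ltnW.
have mi : (i <= m + i < m.+1 + i)%N by rewrite leq_addl addSn ltnSn.
have [v zS [w2 Sw2 vw2]] := zv _ mi; have hm := h0 _ mi.
rewrite addSn elapsedS; move: w1P; set tau := elapsed h (m + i) - elapsed h i.
have tau0 : 0 <= tau.
  rewrite /tau subr_ge0 -[X in elapsed h X <= _]add0n.
  elim: (m) h0 => // p IHp h0; rewrite addSn elapsedS (le_trans (IHp _))//.
    by move=> k /andP[ik km]; apply: h0; rewrite ik addSn ltnS ltnW.
  by rewrite lerDl ltW// h0// leq_addl/= addSn ltnS addSn.
set hk := h (m + i) in hm *.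
have s0 : 0 < tau + hk by rewrite ltr_wpDl.
rewrite (_ : elapsed h (m + i) + hk - elapsed h i = tau + hk); last first.
  by rewrite /tau; ring.
move=> w1P; exists ((tau / (tau + hk)) *: w1 + (hk / (tau + hk)) *: w2).
  apply: convex_setP => //.
  - exact: divr_ge0 tau0 (ltW s0).
  - exact: divr_ge0 (ltW hm) (ltW s0).
  - by rewrite -mulrDl divff// gt_eqF.
rewrite scalerDr !scalerA !(mulrCA (tau + hk)) divff ?gt_eqF// !mulr1 zS -/hk.
rewrite (_ : z i - _ - _ = (z i - z (m + i)%N - tau *: w1) + hk *: (v - w2)).
  rewrite mulrDr; apply: le_trans (ler_normD _ _) _; rewrite lerD//.
  by rewrite normrZ gtr0_norm// mulrC ler_wpM2r// ltW.
by apply/rowP => k; rewrite !mxE; ring.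
Qed.

(** Reading a chain in continuous time through this index gives a piecewise constant
    curve, easier to handle than the polygon and with the same limits. Times outside
    [[0, elapsed h b]] are clamped to the ends of the chain. *)
Definition index_at h (b : nat) (t : R) : nat :=
  (\max_(i < b.+1 | (elapsed h i <= t)%R) i)%N.

Section IndexAt.
Variables (h : nat -> R) (b : nat) (e : R).
Hypothesis h_gt0 : forall k, (k < b)%N -> 0 < h k.
Hypothesis h_le : forall k, (k < b)%N -> h k <= e.
Hypothesis e_ge0 : 0 <= e.
Local Notation idx := (index_at h b).

Lemma index_at_le t : (idx t <= b)%N.
Proof. by apply/bigmax_leqP => i _; rewrite -ltnS. Qed.

Lemma index_at_max t i : (i <= b)%N -> elapsed h i <= t -> (i <= idx t)%N.
Proof.
rewrite -ltnS => ib it.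
exact: (@leq_bigmax_cond _ _ (fun k : 'I_b.+1 => k : nat) (Ordinal ib)).
Qed.

Lemma index_at_elapsed t : 0 <= t -> elapsed h (idx t) <= t.
Proof.
move=> t0; pose P := [pred i : 'I_b.+1 | elapsed h i <= t].
have P0 : (0 < #|P|)%N.
  by apply/card_gt0P; exists ord0; rewrite inE/= elapsed0.
have [i it] := eq_bigmax_cond (fun i : 'I_b.+1 => i : nat) P0.
by rewrite /index_at => ->.
Qed.

Lemma index_at_lt0 t : t < 0 -> idx t = 0%N.
Proof.
move=> t0; apply: big1 => i; rewrite leNgt => /negP[]; apply: lt_le_trans t0 _.
rewrite -(elapsed0 h); apply: (elapsed_homo h_gt0) => //.
by rewrite -ltnS.
Qed.

Lemma index_at0 : idx 0 = 0%N.
Proof.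
apply/eqP; rewrite -leqn0 leqNgt; apply/negP => i0.
have ib := index_at_le 0.
have := index_at_elapsed (lexx 0); apply/negP; rewrite -ltNge.
apply: lt_le_trans (elapsed_homo h_gt0 i0 ib).
by rewrite elapsedS elapsed0 add0r h_gt0// (leq_trans i0).
Qed.

Lemma index_at_elapsed_end : idx (elapsed h b) = b.
Proof. by apply/eqP; rewrite eqn_leq index_at_le index_at_max. Qed.

Lemma index_at_homo s t : s <= t -> (idx s <= idx t)%N.
Proof.
move=> st; apply/bigmax_leqP => i is_; apply: index_at_max.
  by rewrite -ltnS.
exact: le_trans is_ st.
Qed.

Lemma index_at_near t : t <= elapsed h b -> t <= elapsed h (idx t) + e.
Proof.
move=> tb; have := index_at_le t; rewrite leq_eqVlt => /predU1P[ib|ib].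
  by rewrite ib (le_trans tb)// lerDl.
have : t < elapsed h (idx t).+1.
  rewrite ltNge; apply/negP => /(index_at_max ib).
  by rewrite ltnn.
by rewrite elapsedS => /ltW/le_trans; apply; rewrite lerD2l h_le.
Qed.

Lemma index_at_gap s t : s <= t ->
  elapsed h (idx t) - elapsed h (idx s) <= t - s + e.
Proof.
move=> st; have [sb|bs] := leP s (elapsed h b); last first.
  have -> : idx s = b.
    apply/eqP; rewrite eqn_leq index_at_le index_at_max// ltW//.
  have -> : idx t = b.
    apply/eqP; rewrite eqn_leq index_at_le index_at_max//.
    by rewrite (le_trans (ltW bs)).
  by rewrite subrr addr_ge0// subr_ge0.
have := index_at_near sb; have [t0|t0] := leP 0 t.
  by have := index_at_elapsed t0; lra.
rewrite (index_at_lt0 t0) (index_at_lt0 (le_lt_trans st t0)) subrr => _.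
by rewrite addr_ge0// subr_ge0.
Qed.

End IndexAt.
End EulerChains.

(** * Limits of Euler chains are trajectories *)

(** Along an ultrafilter every sequence in a compact set converges. Hence sequences
    of curves with values in a compact set converge pointwise along one and the same
    ultrafilter, without extraction of subsequences. *)
Lemma ultra_compact_cvg (T : topologicalType) (F : set_system nat)
    (K : set T) (u : nat -> T) :
  UltraFilter F -> compact K -> (forall m, K (u m)) ->
  exists2 p, K p & u @ F --> p.
Proof.
move=> FU cK Ku.
have FK : (u @ F) K by apply: (@filterE _ F _ (u @^-1` K)).
have [p [Kp clp]] := cK (u @ F) _ FK.
exists p => // B Bp; have [//|FC] := in_ultra_setVsetC (u @^-1` B) FU.
by have [q []] := clp (~` B) B FC Bp.
Qed.

Lemma norm_ball_compact (R : realType) n (B : R) :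
  compact [set x : 'rV[R]_n | `|x| <= B].
Proof.
apply: bounded_closed_compact.
  exists B; split; first exact: num_real.
  by move=> r Br x /= /le_trans; apply; exact: ltW.
rewrite (_ : [set _ | _] = closed_ball_ Num.norm (0 : 'rV[R]_n) B).
  exact: closed_closed_ball_.
by apply/seteqP; split => x; rewrite /closed_ball_ /= sub0r normrN.
Qed.

Lemma value_closed (R : realType) n (H : 'rV[R]_n -> set 'rV[R]_n) x :
  graph_closed H -> closed (H x).
Proof.
move=> Hc w clw; apply: (Hc (x, w)) => B [[Q1 Q2] [/= Q1x Q2w] QB].
have [w' [Hw' Qw']] := clw _ Q2w.
by exists (x, w'); split=> //; apply: QB; split=> //=; exact: nbhs_singleton.
Qed.

Section VelocityBound.
Context {R : realType} {n : nat}.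
Local Notation V := 'rV[R]_n.
Variables (H : V -> set V) (E : R -> V -> set V).
Hypothesis H_bounded : locally_bounded H.
Hypothesis E_consistent : consistent H E.

Lemma value_bound x : exists M, forall w, H x w -> `|w| <= M.
Proof.
have [W Wx [M [Mr MP]]] := H_bounded x; exists (M + 1) => w Hw.
by apply: MP; [rewrite ltrDl|exists x => //; exact: nbhs_singleton].
Qed.

(** Near each point the velocities are within [1] of a bounded set; compactness makes
    the bound and the admissible steps uniform. *)
Lemma velocity_bound (K : set V) : compact K -> exists2 C, 0 < C &
  \forall e \near 0^'+, forall y v, K y -> E e y v -> `|v| <= C.
Proof.
move=> /compact_near_coveringP cK.
pose F : set_system (R * R) := filter_prod (0^'+) +oo.
have := cK _ F (fun eC y => forall v, E eC.1 y v -> `|v| <= eC.2) _.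
case=> [x Kx|].
  have [[Q1 Q2] [/= Q1x Q2e] Q12] := E_consistent x ltr01.
  have [M MP] := value_bound x.
  exists (Q1, [set eC | Q2 eC.1 /\ M + 1 <= eC.2]).
    split=> //; exists (Q2, [set C | M + 1 <= C]) => //=.
    split=> //; exact: nbhs_pinfty_ge (num_real _).
  move=> [y [e C]] /= [Qy [Qe MC]] v Ev.
  have [w Hw vw] := Q12 (y, e) (conj Qy Qe) v Ev.
  rewrite -(subrK w v) (le_trans (ler_normD _ _))// (le_trans _ MC)// addrC.
  by rewrite lerD// MP.
move=> [Q1 Q2] [/= Q1e Q2C] Q12.
have [C [C0 QC]] := filter_ex (filterI (nbhs_pinfty_gt (num_real 0)) Q2C).
exists C => //; apply: filterS Q1e => e Qe y v Ky.
exact: (Q12 (e, C) (conj Qe QC) y Ky).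
Qed.

End VelocityBound.

Section EulerLimit.
Context {R : realType} {n : nat}.
Local Notation V := 'rV[R]_n.
Local Notation mu := (@lebesgue_measure R).
Variables (H : V -> set V) (E : R -> V -> set V).
Hypothesis H_nonempty : forall x, H x !=set0.
Hypothesis H_convex : forall x, @convex_set R V (H x).
Hypothesis H_closed : graph_closed H.
Hypothesis H_bounded : locally_bounded H.
Hypothesis E_consistent : consistent H E.

Section Curve.
Variables (K : set V) (C Tmax : R).
Variables (h : nat -> nat -> R) (z : nat -> nat -> V) (b : nat -> nat).
Variables (e : nat -> R) (U : set_system nat).
Hypothesis K_compact : compact K.
Hypothesis chain : forall m, euler_chain E K (e m) (h m) (z m) (b m).
Hypothesis chain0 : forall m, K (z m 0).
Hypothesis e_gt0 : forall m, 0 < e m.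
Hypothesis e_cvg0 : e @ U --> 0.
Hypothesis C_ge0 : 0 <= C.
Hypothesis speed : forall m y v d, K y -> 0 < d <= e m -> E d y v -> `|v| <= C.
Hypothesis elapsed_le : forall m, elapsed (h m) (b m) <= Tmax.
Hypothesis U_ultra : UltraFilter U.

Local Notation idx m := (index_at (h m) (b m)).
Let c m t := z m (idx m t).
Let T_ m := elapsed (h m) (b m).

Let h_gt0 m k : (k < b m)%N -> 0 < h m k.
Proof. by move=> /(@chain m)[]. Qed.

Let h_le m k : (k < b m)%N -> h m k <= e m.
Proof. by move=> /(@chain m)[]. Qed.

Let e_ge0 m : 0 <= e m. Proof. exact: ltW. Qed.

Let displacement m i j : (i <= j)%N -> (j <= b m)%N ->
  `|z m i - z m j| <= C * (elapsed (h m) j - elapsed (h m) i).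
Proof.
move=> ij jb.
have cvx0 : @convex_set R V [set 0].
  move=> x y l; rewrite !inE => /= -> ->; apply: val_inj => /=.
  by rewrite /conv /= !scaler0 addr0.
have kb k : (i <= k < j)%N -> (k < b m)%N.
  by move=> /andP[_ /leq_trans]; exact.
have [|||_ ->] := @euler_mean _ _ [set 0] C (h m) (z m) i j cvx0 _ ij.
- by exists 0.
- by move=> k /kb /h_gt0.
- move=> k /kb kb'; have [hk0 hke Kz [v Ev zS]] := @chain m k kb'.
  exists v => //; exists 0 => //; rewrite subr0.
  by apply: (@speed m (z m k) v (h m k)) => //; rewrite hk0.
by rewrite scaler0 subr0.
Qed.

(* Sampling costs one step [e m] in time, so the curves are only almost Lipschitz. *)
Let c_lip m s t : `|c m s - c m t| <= C * (`|s - t| + e m).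
Proof.
wlog st : s t / s <= t => [wl|].
  have [/wl//|/ltW/wl] := leP s t.
  by rewrite distrC [X in _ <= _ * (X + _)]distrC.
have ij := index_at_homo (h m) (b m) st.
apply: le_trans (displacement ij (index_at_le _ _ _)) _.
rewrite ler_wpM2l// distrC ger0_norm ?subr_ge0//.
exact: index_at_gap (@h_gt0 m) (@h_le m) (e_ge0 m) _ _ st.
Qed.

Let c0 m : c m 0 = z m 0.
Proof. by rewrite /c (index_at0 (@h_gt0 m)). Qed.

Let cT m : c m (T_ m) = z m (b m).
Proof. by rewrite /c index_at_elapsed_end. Qed.

Let T_ge0 m : 0 <= T_ m.
Proof. by rewrite /T_ -(elapsed0 (h m)) (elapsed_homo (@h_gt0 m)). Qed.

Let c_cvg t : exists p : V, c m t @[m --> U] --> p.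
Proof.
have [M [Mr MP]] := compact_bounded K_compact.
pose B := M + 1 + C * Tmax.
have bB := @norm_ball_compact R n B.
have [m|p _ cp] := ultra_compact_cvg (u := fun m => c m t) U_ultra bB;
  last by exists p.
rewrite /= /c -(subrK (z m 0) (z m _)) (le_trans (ler_normD _ _))//.
rewrite addrC lerD//; first by apply: MP => //; rewrite ltrDl.
rewrite distrC (le_trans (displacement _ (index_at_le _ _ _)))//.
rewrite ler_wpM2l// elapsed0 subr0 (le_trans _ (elapsed_le m))//.
exact: (elapsed_homo (@h_gt0 m) (index_at_le _ _ _)).
Qed.

Let g t := sval (cid (c_cvg t)).

Let g_cvg t : c m t @[m --> U] --> g t.
Proof. exact: svalP (cid (c_cvg t)). Qed.

Let T_cvg : exists2 p, 0 <= p <= Tmax & T_ m @[m --> U] --> p.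
Proof.
have [m|p] := ultra_compact_cvg (u := T_) U_ultra (@segment_compact R 0 Tmax).
  by rewrite /= in_itv /= T_ge0 elapsed_le.
by rewrite /= in_itv /= => pT Tp; exists p.
Qed.

Let T := sval (cid2 T_cvg).

Let T_itv : 0 <= T <= Tmax.
Proof. by rewrite /T; case: cid2. Qed.

Let T_cvgT : T_ m @[m --> U] --> T.
Proof. by rewrite /T; case: cid2. Qed.

Let g_near t r : 0 < r -> \forall m \near U, `|g t - c m t| <= r.
Proof. by move=> r0; move/cvgrPdist_le: (@g_cvg t) => /(_ r r0). Qed.

Let T_near r : 0 < r -> \forall m \near U, `|T - T_ m| <= r.
Proof. by move=> r0; move/cvgrPdist_le: T_cvgT => /(_ r r0). Qed.

Let e_near r : 0 < r -> \forall m \near U, e m <= r.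
Proof.
move=> r0; move/cvgrPdist_le: e_cvg0 => /(_ r r0); apply: filterS => m.
by rewrite sub0r normrN gtr0_norm.
Qed.

Let g_lip s t : `|g s - g t| <= C * `|s - t|.
Proof.
apply/ler_addgt0Pr => r r0; pose r' := r / (C + 2).
have C20 : 0 < C + 2 by rewrite ltr_wpDl.
have r'0 : 0 < r' by rewrite divr_gt0.
have [m [[gs gt] em]] := filter_ex (filterI (filterI
  (g_near s r'0) (g_near t r'0)) (e_near r'0)).
rewrite (_ : g s - g t = (g s - c m s) + (c m s - c m t) - (g t - c m t)); last first.
  by apply/rowP => k; rewrite !mxE; ring.
apply: le_trans (ler_normB _ _) _; apply: le_trans (lerD (ler_normD _ _) (lexx _)) _.
have := @c_lip m s t; have : C * e m <= C * r' by rewrite ler_wpM2l.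
have -> : r = r' * (C + 2) by rewrite /r' divfK ?gt_eqF.
rewrite mulrDr; lra.
Qed.

Let g0_cvg : z m 0 @[m --> U] --> g 0.
Proof. by have := @g_cvg 0; under eq_fun do rewrite c0. Qed.

Let gT_cvg : z m (b m) @[m --> U] --> g T.
Proof.
apply/cvgrPdist_le => r r0; pose r' := r / (1 + C * 2).
have C20 : 0 < 1 + C * 2 by rewrite ltr_pwDl// mulr_ge0.
have r'0 : 0 < r' by rewrite divr_gt0.
apply: filterS (filterI (filterI (g_near T r'0) (T_near r'0)) (e_near r'0)).
move=> m [[gT TT] em].
rewrite -cT -(subrK (c m T) (g T)) -addrA (le_trans (ler_normD _ _))//.
have := @c_lip m T (T_ m).
have : C * (`|T - T_ m| + e m) <= C * (r' + r') by rewrite ler_wpM2l// lerD.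
have -> : r = r' * (1 + C * 2) by rewrite /r' divfK ?gt_eqF.
move: gT; nra.
Qed.

(** The derivative lies in the closed convex set [- H (g t)] because the difference
    quotients to the right of [t] do up to an arbitrarily small error. *)
Let g_velocity t : 0 < t < T -> derivable g t 1 -> H (g t) (- derive1 g t).
Proof.
move=> /andP[t0 tT] dg.
have [M HM] := value_bound H_bounded (g t).
apply: (value_closed H_closed) => B /nbhs_ballP[r /= r0 rB].
pose d := r / 4; have d0 : 0 < d by rewrite divr_gt0.
have [[Q1 Q2] [/= /nbhs_ballP[q1 /= q10 Q1q] [q2 /= q20 Q2q]] Q12] :=
  E_consistent (g t) d0.
have C10 : 0 < C + 1 by rewrite ltr_wpDl.
have q0 : 0 < q1 / (2 * (C + 1)) by rewrite divr_gt0// mulr_gt0.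
(* On a short time interval to the right of [t], the chains use only velocities
   that are [d]-close to [H (g t)]. *)
have quotient_near : \forall s \near t^'+, exists2 w, H (g t) w &
    `|g t - g s - (s - t) *: w| <= 2 * d * (s - t).
  have : \forall s \near t^'+, [/\ s < t + q1 / (2 * (C + 1)), t < s & s < T].
    near=> s; split; near: s.
    - by apply: nbhs_right_lt; rewrite ltrDl.
    - exact: nbhs_right_gt.
    - exact: nbhs_right_lt.
  apply: filterS => s [sq ts sT].
  have sg0 : 0 < s - t by rewrite subr_gt0.
  (* The tolerance [a] keeps [s] below the final time of the chain, keeps the chain
     in the region where [Q12] applies, and makes the total error, at most
     [d * (s - t) + a * N], smaller than [2 * d * (s - t)]. *)
  pose N := 2 + d + `|M|; have N0 : 0 < N by rewrite ltr_pwDl// addr_gt0.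
  pose a := Num.min (Num.min (T - s) (q2 / 2))
                    (Num.min (q1 / (2 * (C + 1))) (d * (s - t) / N)).
  have a0 : 0 < a.
    by rewrite !lt_min subr_gt0 sT q0 !divr_gt0// mulr_gt0.
  have [m [[[gt gs] em] Tm]] := filter_ex (filterI (filterI (filterI
    (g_near t a0) (g_near s a0)) (e_near a0)) (T_near a0)).
  have : a <= a by []; rewrite {2}/a !le_min => /andP[/andP[aT aq2] /andP[aq1 aN]].
  have sTm : s <= T_ m by move: Tm; rewrite ler_norml; lra.
  set i := idx m t; set j := idx m s.
  have ij : (i <= j)%N := index_at_homo _ _ (ltW ts).
  have jb : (j <= b m)%N := index_at_le _ _ _.
  have := @index_at_gap _ _ _ _ (@h_gt0 m) (@h_le m) (e_ge0 m) _ _ (ltW ts).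
  have := @index_at_near _ _ _ _ (@h_le m) (e_ge0 m) _ sTm.
  have := @index_at_elapsed _ (h m) (b m) t (ltW t0).
  rewrite -/i -/j => ti sj tau_le.
  have [|k /andP[ik kj]|k /andP[ik kj]|w Hw ijw] := @euler_mean _ _ (H (g t)) d
      (h m) (z m) i j (@H_convex _) _ ij.
  - exact: H_nonempty.
  - exact: h_gt0 (leq_trans kj jb).
  - have [hk0 hke Kz [v Ev zS]] := chain (leq_trans kj jb).
    exists v => //; apply: (Q12 (z m k, h m k)) => //=; split; last first.
      apply: Q2q => //=; rewrite sub0r normrN gtr0_norm//.
      apply: le_lt_trans hke _; apply: le_lt_trans em _.
      by apply: le_lt_trans aq2 _; rewrite ltr_pdivrMr// ltr_pMr// ltr1n.
    apply: Q1q; rewrite -ball_normE /= -(subrK (z m i) (g t)) -addrA.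
    apply: le_lt_trans (ler_normD _ _) _.
    have zik := displacement ik (leq_trans (ltnW kj) jb).
    have kj' := elapsed_homo (fun l lj => h_gt0 (leq_trans lj jb)) (ltnW kj)
      (leqnn _).
    have : C * (elapsed (h m) k - elapsed (h m) i) <= C * (s - t + a).
      by rewrite ler_wpM2l//; move: kj' tau_le em; lra.
    move: gt; rewrite /c -/i => gt.
    move: aq1 sq; rewrite -ltrBlDl ler_pdivlMr ?ltr_pdivlMr ?mulr_gt0//.
    move: zik gt sg0; set X := `|_|; set Y := `|_|; lra.
  exists w => //; move: ijw gt gs; rewrite /c -/i -/j => ijw gt gs.
  set tau := elapsed (h m) j - elapsed (h m) i in tau_le ijw.
  have taus : `|tau - (s - t)| <= a.
    rewrite ler_norml; move: tau_le em ti sj; rewrite /tau; lra.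
  have -> : g t - g s - (s - t) *: w = (g t - z m i) - (g s - z m j) +
      (z m i - z m j - tau *: w) + (tau - (s - t)) *: w.
    by apply/rowP => k; rewrite !mxE; ring.
  have wM : `|tau - (s - t)| * `|w| <= a * `|M|.
    by rewrite ler_pM// (le_trans (HM _ Hw))// ler_norm.
  have dtau : d * tau <= d * (s - t + a).
    by rewrite ler_wpM2l ?(ltW d0)//; move: tau_le em; lra.
  have aN' : a * N <= d * (s - t) by rewrite -ler_pdivlMr.
  do 2 (apply: le_trans (ler_normD _ _) _; rewrite -lerBrDr).
  apply: le_trans (ler_normB _ _) _; rewrite normrZ.
  move: wM dtau aN' gt gs ijw; rewrite /N.
  set X := `|_|; set Y := `|_|; set Z := `|_|; set W := `|_ - _| * _.
  lra.
have dq : \forall s \near t^'+, `|derive1 g t - (s - t)^-1 *: (g s - g t)| <= d.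
  have /cvgrPdist_le/(_ d d0)[q /= q3 qP] :
    (fun x : R => x^-1 *: ((g \o shift t) (x *: 1) - g t)) @ 0^' --> 'D_1 g t
    by exact: dg.
  near=> s; have ts : t < s by near: s; exact: nbhs_right_gt.
  have := qP (s - t); rewrite /= sub0r normrN derive1E scaler1 subrK; apply.
    rewrite gtr0_norm ?subr_gt0// ltrBlDl; near: s; apply: nbhs_right_lt.
    by rewrite ltrDl.
  by rewrite gt_eqF// subr_gt0.
near (t^'+) => s.
have [w Hw ws] : exists2 w, H (g t) w &
  `|g t - g s - (s - t) *: w| <= 2 * d * (s - t) by near: s.
have ds : `|derive1 g t - (s - t)^-1 *: (g s - g t)| <= d by near: s.
have ts : t < s by near: s; exact: nbhs_right_gt.
exists w; split=> //; apply: rB; rewrite -ball_normE /=.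
have st0 : 0 < s - t by rewrite subr_gt0.
rewrite (_ : _ - w = - (derive1 g t - (s - t)^-1 *: (g s - g t)) +
    (s - t)^-1 *: (g t - g s - (s - t) *: w)); last first.
  by apply/rowP => k; rewrite !mxE; field; rewrite gt_eqF.
apply: le_lt_trans (ler_normD _ _) _; rewrite normrN normrZ gtr0_norm ?invr_gt0//.
have : (s - t)^-1 * `|g t - g s - (s - t) *: w| <= 2 * d.
  by rewrite mulrC ler_pdivrMr.
by rewrite /d in ds *; lra.
Unshelve. all: by end_near. Qed.

(** The limit curve [g] is a solution up to time [T] only; a trajectory from [g T]
    completes it. *)
Lemma euler_curve : solvable_everywhere H -> exists gamma p,
  [/\ trajectory H gamma, 0 <= p <= Tmax,
      z m 0 @[m --> U] --> gamma 0, z m (b m) @[m --> U] --> gamma p &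
      elapsed (h m) (b m) @[m --> U] --> p].
Proof.
move=> /(_ (g T)) [g2 g2H g20]; have T0 : 0 <= T by have /andP[] := T_itv.
exists (concat T g g2), T; split=> //.
- apply: concat_trajectory => //; first exact: lipschitz_absolutely_continuous g_lip.
  have aeF := ae_filter_ringOfSetsType mu.
  have : {ae mu, forall t, forall i : 'I_n, derivable (fun t => g t ord0 i) t 1}.
    apply: filter_forall => i; apply: (@lipschitz_ae_derivable _ _ C) => s t.
    apply: le_trans (g_lip s t); apply: le_trans (coord_le_norm _ i).
    by rewrite !mxE.
  apply: filterS => t dg tT.
  have dgt : derivable g t 1 by apply/derivable_mxP => i j; rewrite ord1.
  by split=> //; exact: g_velocity.
- by rewrite /concat T0.
- by rewrite /concat lexx.
Qed.

End Curve.

(** A closed property of the end points and the duration that chains with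
    arbitrarily small steps can satisfy is satisfied by some trajectory. The
    parameter of [P] makes room for tolerances that shrink with the steps. *)
Lemma euler_limit (K : set V) (Tmax : R) (P : R -> set (V * V * R)) :
  solvable_everywhere H -> compact K ->
  (forall e, 0 < e -> closed (P e)) ->
  (forall e e', 0 < e -> e <= e' -> P e `<=` P e') ->
  (forall e, 0 < e -> exists h z b, [/\ euler_chain E K e h z b, K (z 0%N),
    elapsed h b <= Tmax & P e (z 0%N, z b, elapsed h b)]) ->
  exists gamma t, [/\ trajectory H gamma, 0 <= t <= Tmax &
    forall e, 0 < e -> P e (gamma 0, gamma t, t)].
Proof.
move=> H_solvable K_compact P_closed P_homo bad.
have [C C0 [e0 /= e00 Cb]] := velocity_bound H_bounded E_consistent K_compact.
pose e m : R := (e0 / 2) * harmonic m.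
have em0 m : 0 < e m by rewrite mulr_gt0 ?harmonic_gt0// divr_gt0.
have eme0 m : e m < e0.
  apply: (@le_lt_trans _ _ (e0 / 2)); last first.
    by rewrite ltr_pdivrMr// ltr_pMr// ltr1n.
  by rewrite ler_piMr ?divr_ge0 ?(ltW e00)//= invf_le1 ?ltr0n// ler1n.
have e_cvg : e @ \oo --> 0.
  by rewrite -(mulr0 (e0 / 2)); apply: cvgMr; exact: cvg_harmonic.
have /choice[hzb hzbP] : forall m, exists hzb : (nat -> R) * (nat -> V) * nat,
    [/\ euler_chain E K (e m) hzb.1.1 hzb.1.2 hzb.2, K (hzb.1.2 0%N),
    elapsed hzb.1.1 hzb.2 <= Tmax &
    P (e m) (hzb.1.2 0%N, hzb.1.2 hzb.2, elapsed hzb.1.1 hzb.2)].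
  by move=> m; have [h [z [b Phzb]]] := bad _ (em0 m); exists (h, z, b).
have [U [U_ultra U_oo]] := @ultraFilterLemma _ \oo _.
have e_cvgU : e @ U --> 0 by move=> B /e_cvg /U_oo.
have [||||gamma [t [gH tT z0 zb Tt]]] := @euler_curve K C Tmax
  (fun m => (hzb m).1.1) (fun m => (hzb m).1.2) (fun m => (hzb m).2) e U
  K_compact _ _ em0 e_cvgU (ltW C0) _ _ U_ultra H_solvable.
- by move=> m; have [] := hzbP m.
- by move=> m; have [] := hzbP m.
- move=> m y v d Ky /andP[d0 de]; apply: Cb => //=.
  by rewrite sub0r normrN gtr0_norm// (le_lt_trans de).
- by move=> m; have [] := hzbP m.
exists gamma, t; split=> // r r0.
have e_near : \forall m \near U, e m <= r.
  move/cvgrPdist_le: e_cvgU => /(_ r r0); apply: filterS => m.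
  by rewrite sub0r normrN gtr0_norm.
apply: (@closed_cvg _ _ U _ (fun m => ((hzb m).1.2 0%N,
  (hzb m).1.2 (hzb m).2, elapsed (hzb m).1.1 (hzb m).2)) (P r)).
- exact: P_closed.
- apply: filterS e_near => m emr; have [_ _ _] := hzbP m.
  exact: P_homo.
- exact: (cvg_pair (cvg_pair z0 zb) Tt).
Qed.

End EulerLimit.

(** * Lyapunov functions along Euler chains *)

Lemma finite_near (I : choiceType) (T : Type) (F : set_system T) (C : set I)
    (P : I -> T -> Prop) : Filter F -> finite_set C ->
  (forall c, C c -> \forall t \near F, P c t) ->
  \forall t \near F, forall c, C c -> P c t.
Proof.
move=> FF /finite_fsetP[X ->] CP.
by have := @filter_bigI T I X P F FF CP; apply: filterS => t Pt c Xc; exact: Pt.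
Qed.

Lemma closed_le_fun (R : realType) (T : topologicalType) (f g : T -> R) :
  continuous f -> continuous g -> closed [set x | f x <= g x].
Proof.
move=> cf cg.
rewrite (_ : [set _ | _] = (fun x => g x - f x) @^-1` [set r | 0 <= r]).
  apply: preimage_closed => [x _|]; last exact: closed_ge.
  by apply: cvgB; [exact: cg|exact: cf].
by apply/seteqP; split => x /=; rewrite subr_ge0.
Qed.

Lemma continuous_dist (R : realType) (T : topologicalType) (f : T -> R) (c : R) :
  continuous f -> continuous (fun x => `|f x - c|).
Proof.
by move=> cf x; apply: cvg_norm; apply: cvgB; [exact: cf|exact: cvg_cst].
Qed.

Lemma compact_closed_separated (R : realType) n (B A : set 'rV[R]_n) :
  compact B -> closed A -> (forall x, B x -> ~ A x) ->
  exists2 r : R, 0 < r & forall x a, B x -> A a -> r <= `|x - a|.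
Proof.
move=> /compact_near_coveringP cB cA BA.
have := cB R (0^'+) (fun r x => forall a, A a -> r <= `|x - a|) _.
case=> [x Bx|r /= r0 rP].
  have /nbhs_ballP[q /= q0 qA] : nbhs x (~` A).
    by apply: open_nbhs_nbhs; split; [exact: closed_openC|exact: BA].
  near=> y r => a Aa /=; rewrite leNgt; apply/negP => yar; apply: (qA a) => //.
  rewrite -ball_normE /= -(subrK y x) -addrA (le_lt_trans (ler_normD _ _))//.
  rewrite [ltRHS]splitr ltrD//.
    near: y; apply: cvgr_dist_lt; [exact: cvg_id|by rewrite divr_gt0].
  apply: lt_trans yar _; near: r; apply: nbhs_right_lt; by rewrite divr_gt0.
exists (r / 2); first by rewrite divr_gt0.
move=> x a Bx Aa; apply: (rP (r / 2)) => //=; last by rewrite divr_gt0.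
by rewrite sub0r normrN gtr0_norm ?divr_gt0// ltr_pdivrMr// ltr_pMr// ltr1n.
Unshelve. all: by end_near. Qed.

Section Lyapunov.
Context {R : realType} {n : nat}.
Local Notation V := 'rV[R]_n.
Variables (H : V -> set V) (E : R -> V -> set V).
Hypothesis H_nonempty : forall x, H x !=set0.
Hypothesis H_convex : forall x, @convex_set R V (H x).
Hypothesis H_closed : graph_closed H.
Hypothesis H_bounded : locally_bounded H.
Hypothesis H_solvable : solvable_everywhere H.
Hypothesis E_consistent : consistent H E.
Variables (A : set V) (Psi : V -> R).
Hypothesis Psi_lyapunov : lyapunov H Psi A.

Let Psi_cont : continuous Psi. Proof. by case: Psi_lyapunov. Qed.
Let A_closed : closed A. Proof. by case: Psi_lyapunov. Qed.

(** The contrapositive of [euler_limit]: what no trajectory can do, no chain with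
    small steps can do. *)
Lemma euler_near (K : set V) (Tmax : R) (P : R -> set (V * V * R)) :
  compact K ->
  (forall e, 0 < e -> closed (P e)) ->
  (forall e e', 0 < e -> e <= e' -> P e `<=` P e') ->
  (forall gamma t, trajectory H gamma -> 0 <= t <= Tmax ->
    exists2 e, 0 < e & ~ P e (gamma 0, gamma t, t)) ->
  \forall e \near 0^'+, forall h z b, euler_chain E K e h z b -> K (z 0%N) ->
    elapsed h b <= Tmax -> ~ P e (z 0%N, z b, elapsed h b).
Proof.
move=> K_compact P_closed P_homo noP.
suff [e1 e10 e1P] : exists2 e1, 0 < e1 & forall h z b,
    euler_chain E K e1 h z b -> K (z 0%N) ->
    elapsed h b <= Tmax -> ~ P e1 (z 0%N, z b, elapsed h b).
  near=> e; have e0 : 0 < e by near: e; exact: nbhs_right_gt.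
  have ee1 : e <= e1 by near: e; exact: nbhs_right_le.
  move=> h z b hzb Kz hb Pe; apply: (e1P h z b) => //; last exact: P_homo ee1 _ Pe.
  by move=> j /hzb[? he ? ?]; split=> //; exact: le_trans ee1.
apply/not_exists2P => bad.
have [|gamma [t [gH tT Pg]]] := euler_limit H_nonempty H_convex H_closed
    H_bounded E_consistent H_solvable K_compact P_closed P_homo (Tmax := Tmax).
  move=> e e0; apply/not_existsP => nh.
  have [//|] := bad e; apply=> h z b hzb Kz hb Pe.
  by apply: (nh h); exists z, b.
by have [e e0] := noP gamma t gH tT; apply; exact: Pg.
Unshelve. all: by end_near. Qed.

Lemma lyapunov_le gamma t : trajectory H gamma -> 0 <= t ->
  Psi (gamma t) <= Psi (gamma 0).
Proof.
have [_ _ lyap] := Psi_lyapunov => /lyap[gA gnA].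
rewrite le_eqVlt => /predU1P[<-//|t0].
have [A0|A0] := pselect (A (gamma 0)); first exact/gnA/ltW.
exact/ltW/gA.
Qed.

Lemma euler_lyapunov_le (K : set V) (d Tmax : R) : compact K -> 0 < d ->
  \forall e \near 0^'+, forall h z b, euler_chain E K e h z b -> K (z 0%N) ->
    elapsed h b <= Tmax -> Psi (z b) < Psi (z 0%N) + d.
Proof.
move=> K_compact d0.
pose P (e : R) : set (V * V * R) := [set p | Psi p.1.1 + d <= Psi p.1.2].
have : \forall e \near 0^'+, forall h z b, euler_chain E K e h z b -> K (z 0%N) ->
    elapsed h b <= Tmax -> ~ P e (z 0%N, z b, elapsed h b).
  apply: euler_near => //.
  - move=> e _; apply: closed_le_fun => x.
      apply: cvgD; last exact: cvg_cst.
      apply: (cvg_comp _ _ (cvg_comp _ _ cvg_fst cvg_fst)); exact: Psi_cont.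
    apply: (cvg_comp _ _ (cvg_comp _ _ cvg_fst cvg_snd)); exact: Psi_cont.
  - by move=> e e1 _ _ q.
  - move=> gamma t gH /andP[t0 _]; exists 1 => //; rewrite /P /= => Pd.
    have := lyapunov_le gH t0; rewrite leNgt => /negP; apply.
    by apply: lt_le_trans Pd; rewrite ltrDl.
by apply: filterS => e eP h z b hzb Kz hb; rewrite ltNge; apply/negP => zb;
  exact: (eP h z b).
Qed.

(** One bound [e] serves both as maximal step and as guaranteed drop: in the limit
    [e -> 0] a violation would leave a trajectory starting outside [A] on which
    [Psi] does not decrease. *)
Lemma euler_lyapunov_lt (K : set V) (r tau Tmax : R) :
  compact K -> 0 < r -> 0 < tau ->
  \forall e \near 0^'+, forall h z b, euler_chain E K e h z b -> K (z 0%N) ->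
    tau <= elapsed h b <= Tmax -> (forall a, A a -> r <= `|z 0%N - a|) ->
    Psi (z b) < Psi (z 0%N) - e.
Proof.
move=> K_compact r0 tau0.
pose P (e : R) : set (V * V * R) := [set p | (forall a, A a -> r <= `|p.1.1 - a|)]
  `&` [set p | tau <= p.2] `&` [set p | Psi p.1.1 - e <= Psi p.1.2].
have c11 (x : V * V * R) : (fun p => p.1.1) @ x --> x.1.1.
  exact: (cvg_comp _ _ cvg_fst cvg_fst).
have c12 (x : V * V * R) : (fun p => p.1.2) @ x --> x.1.2.
  exact: (cvg_comp _ _ cvg_fst cvg_snd).
have : \forall e \near 0^'+, forall h z b, euler_chain E K e h z b -> K (z 0%N) ->
    elapsed h b <= Tmax -> ~ P e (z 0%N, z b, elapsed h b).
  apply: euler_near => //.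
  - move=> e _; apply: closedI; [apply: closedI|].
    + rewrite (_ : [set _ | _] =
        \bigcap_(a in A) [set p : V * V * R | r <= `|p.1.1 - a|])//.
      apply: closed_bigI => a _; apply: closed_le_fun => x; first exact: cvg_cst.
      by apply: cvg_norm; apply: cvgB; [exact: c11|exact: cvg_cst].
    + by apply: closed_le_fun => x; [exact: cvg_cst|exact: cvg_snd].
    + apply: closed_le_fun => x; last by apply: cvg_comp (c12 x) _; exact: Psi_cont.
      apply: cvgB; last exact: cvg_cst.
      by apply: cvg_comp (c11 x) _; exact: Psi_cont.
  - move=> e e' _ ee' p [[pA pt] pP]; split => //=; apply: le_trans pP.
    by rewrite lerB.
  - move=> gamma t gH /andP[t0 _]; have [tt|tt] := ltP t tau.
      by exists 1 => // -[[_ /=]]; rewrite leNgt tt.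
    have [_ _ lyap] := Psi_lyapunov; have [gnA _] := lyap _ gH.
    have [A0|/gnA/(_ t (lt_le_trans tau0 tt)) gt] := pselect (A (gamma 0)).
      exists 1 => // -[[/(_ _ A0) + _] _]; rewrite /= subrr normr0 leNgt.
      by rewrite r0.
    exists ((Psi (gamma 0) - Psi (gamma t)) / 2).
      by rewrite divr_gt0// subr_gt0.
    by move=> [_ /=]; move: gt; lra.
apply: filterS => e eP h z b hzb Kz /andP[th hT] zA.
by rewrite ltNge; apply/negP => zb; apply: (eP h z b).
Qed.

(** ** Infinite chains *)

Definition divergent (h : nat -> R) := forall M, exists b, M <= elapsed h b.

Lemma elapsed_shift (h : nat -> R) a b :
  elapsed (fun j => h (a + j)%N) b = elapsed h (a + b) - elapsed h a.
Proof.
elim: b => [|b IH]; first by rewrite addn0 elapsed0 subrr.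
by rewrite addnS !elapsedS IH addrAC.
Qed.

Lemma divergent_shift (h : nat -> R) a : (forall j, 0 < h j) ->
  divergent h -> divergent (fun j => h (a + j)%N).
Proof.
move=> h0 hoo M; have [b bM] := hoo (M + elapsed h a); exists b.
rewrite elapsed_shift lerBrDr (le_trans bM)//.
by apply: (@elapsed_homo _ _ (a + b)) => //; rewrite leq_addl.
Qed.

(** With steps at most [1], time cannot jump over the window [[1, 2]]. *)
Lemma unit_time (h : nat -> R) b : (forall j, 0 < h j <= 1) -> 1 <= elapsed h b ->
  exists2 c, (0 < c <= b)%N & 1 <= elapsed h c <= 2.
Proof.
move=> h1; elim: b => [|b IH]; first by rewrite elapsed0 ler10.
have [|b1] := leP 1 (elapsed h b).
  by move=> /IH[c /andP[c0 cb] c12] _; exists c; rewrite // c0 ltnW.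
move=> b2; exists b.+1; rewrite ?leqnn// b2 elapsedS /=.
by have /andP[_] := h1 b; move: b1; lra.
Qed.

(** The chain is cut into pieces of duration between [1] and [2]. A piece that starts
    in the band [[l, l + d]] ends lower than it started, and a piece that starts
    below the band gains less than [d]; so every piece ends at or below [l + d], and
    within a piece [Psi] exceeds this by at most [d]. *)
Lemma euler_trap (K : set V) (l d : R) : compact K -> 0 < d ->
  (forall x, Psi x <= l + 2 * d -> K x) ->
  (forall a, A a -> ~~ (l <= Psi a <= l + d)) ->
  \forall e \near 0^'+, forall h z, (forall j, 0 < h j <= e) ->
    (forall j, K (z j) -> euler_step E h z j) ->
    Psi (z 0%N) <= l + d -> forall j, Psi (z j) <= l + 2 * d.
Proof.
move=> K_compact d0 subK Ald.
pose B := K `&` [set x | l <= Psi x] `&` [set x | Psi x <= l + d].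
have [r r0 rB] : exists2 r : R, 0 < r & forall x a, B x -> A a -> r <= `|x - a|.
  apply: compact_closed_separated => //.
    apply: compact_closedI; first apply: compact_closedI => //.
      by apply: closed_le_fun => //; exact: cst_continuous.
    by apply: closed_le_fun => //; exact: cst_continuous.
  by move=> x [[_ /= lx] xl] /Ald; rewrite lx xl.
near=> e => h z he zstep z0.
have e1 : e <= 1 by near: e; exact: nbhs_right_le.
have C1 : forall h z b, euler_chain E K e h z b -> K (z 0%N) ->
    elapsed h b <= 2 -> Psi (z b) < Psi (z 0%N) + d.
  by near: e; exact: euler_lyapunov_le.
have C2 : forall h z b, euler_chain E K e h z b -> K (z 0%N) ->
    1 <= elapsed h b <= 2 -> (forall a, A a -> r <= `|z 0%N - a|) ->
    Psi (z b) < Psi (z 0%N) - e.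
  by near: e; exact: euler_lyapunov_lt.
have e0 : 0 < e by near: e; exact: nbhs_right_gt.
elim/ltn_ind => j IHj.
have Kz i : (i < j)%N -> K (z i) by move=> ij; exact/subK/IHj.
suff main : forall len a, (a + len)%N = j -> Psi (z a) <= l + d ->
    Psi (z j) <= l + 2 * d.
  exact: main j 0%N (add0n _) z0.
elim/ltn_ind => -[|len] IH a aj za.
  by rewrite -aj addn0 (le_trans za)// lerD2l ler_peMl ?ltW// ltr1n.
have aj' : (a < j)%N by rewrite -aj -addSnnS leq_addr.
pose h' k := h (a + k)%N; pose z' k := z (a + k)%N.
have chain b : (b <= len.+1)%N -> euler_chain E K e h' z' b.
  move=> bl k kb; have akj : (a + k < j)%N by rewrite -aj ltn_add2l (leq_trans kb).
  have /andP[hk0 hke] := he (a + k)%N; split=> //; first exact: Kz.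
  by have [v Ev zv] := zstep _ (Kz _ akj); exists v; rewrite // /z' addnS.
have z'0 : z' 0%N = z a by rewrite /z' addn0.
have Kz'0 : K (z' 0%N) by rewrite z'0; exact: Kz.
have z'l : z' len.+1 = z j by rewrite /z' aj.
have [el|el] := leP (elapsed h' len.+1) 2.
  have := C1 h' z' len.+1 (chain _ (leqnn _)) Kz'0 el.
  by rewrite z'0 z'l; move: za; lra.
have [c /andP[c0 cl] c12] :
    exists2 c, (0 < c <= len.+1)%N & 1 <= elapsed h' c <= 2.
  apply: unit_time; last by move: el; lra.
  by move=> k; have /andP[-> /le_trans] := he (a + k)%N; apply.
have cl' : (c < len.+1)%N.
  rewrite ltn_neqAle cl andbT; apply: contraTneq c12 => ->.
  by rewrite negb_and -!ltNge el orbT.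
apply: (IH (len.+1 - c)%N _ (a + c)%N).
- by rewrite ltn_subrL c0.
- by rewrite -addnA subnKC.
have [la|al] := leP l (Psi (z a)).
  have := C2 h' z' c (chain _ cl) Kz'0 c12.
  rewrite z'0 => /(_ _)/ltW/le_trans; apply.
    by move=> a' Aa'; apply: rB => //; split=> //; split=> //; exact: Kz.
  by move: za e0; lra.
have := C1 h' z' c (chain _ cl) Kz'0.
rewrite z'0 -/(z' c) => /(_ _)/ltW/le_trans; apply.
  by have /andP[] := c12.
by move: al; lra.
Unshelve. all: by end_near. Qed.

(** ** Long-run behaviour *)

(** [Psi] drops as long as it is [k]-away from all critical values, so it comes
    [k]-close to some critical value [c] infinitely often. Trapping below
    [c + k + k] bounds [Psi] above from then on, and trapping below
    [c - 4 * k + k] excludes that it ever goes below [c - 3 * k], as it could not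
    come back to [c]. In this window of width [6 * k <= e1] there is no room for the
    drop [e1]. *)
Lemma euler_asymptotics (top eps : R) :
  compact [set x | Psi x <= top] -> finite_set (Psi @` A) ->
  (forall a, A a -> Psi a + 1 <= top) -> 0 < eps ->
  \forall e \near 0^'+, forall h z, (forall j, 0 < h j <= e) -> divergent h ->
    (forall j, Psi (z j) <= top) -> (forall j, euler_step E h z j) ->
    \forall j \near \oo, (exists2 a, A a & `|z j - a| < eps) /\
                         (exists2 a, A a & `|Psi (z j) - Psi a| < eps).
Proof.
set K := [set x | _]; move=> K_compact C_finite Atop eps0.
(* [e1] is a drop of [Psi] guaranteed at distance [eps] from [A]; the window
   around a critical value has to be narrower than that. *)
have [e1 [e10 e11 drop]] : exists e1, [/\ 0 < e1, e1 <= 1 & forall h z b,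
    euler_chain E K e1 h z b -> K (z 0%N) -> 1 <= elapsed h b <= 2 ->
    (forall a, A a -> eps <= `|z 0%N - a|) -> Psi (z b) < Psi (z 0%N) - e1].
  near (0 : R)^'+ => e1; exists e1; split.
  - by near: e1; exact: nbhs_right_gt.
  - by near: e1; exact: nbhs_right_le.
  - by near: e1; exact: euler_lyapunov_lt.
(* The bands used around [c] reach down to [c - 4 * k]; they meet no other critical
   value. *)
have gap : \forall k \near 0^'+, forall c, (Psi @` A) c ->
    forall c', (Psi @` A) c' -> c <> c' -> 4 * k < `|c - c'|.
  apply: finite_near => // c Cc; apply: finite_near => // c' Cc'.
  have [->|/eqP cc'] := pselect (c = c'); first by apply: filterE => k /(_ erefl).
  near=> k => _; rewrite mulrC -ltr_pdivlMr//; near: k.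
  by apply: nbhs_right_lt; rewrite divr_gt0// normr_gt0 subr_eq0.
have [k [k0 ke1 keps k3 kgap]] : exists k, [/\ 0 < k, 6 * k <= e1, 3 * k < eps,
    3 * k <= 1 & forall c, (Psi @` A) c ->
    forall c', (Psi @` A) c' -> c <> c' -> 4 * k < `|c - c'|].
  near (0 : R)^'+ => k; exists k; split.
  - by near: k; exact: nbhs_right_gt.
  - by rewrite mulrC -ler_pdivlMr//; near: k; apply: nbhs_right_le; rewrite divr_gt0.
  - by rewrite mulrC -ltr_pdivlMr//; near: k; apply: nbhs_right_lt; rewrite divr_gt0.
  - by rewrite mulrC -ler_pdivlMr//; near: k; apply: nbhs_right_le; rewrite divr_gt0.
  - by near: k.
pose B := K `&` [set x | forall c, (Psi @` A) c -> k <= `|Psi x - c|].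
have [r r0 rB] : exists2 r : R, 0 < r & forall x a, B x -> A a -> r <= `|x - a|.
  apply: compact_closed_separated => //.
    apply: compact_closedI => //.
    rewrite (_ : [set _ | _] =
      \bigcap_(c in Psi @` A) [set x | k <= `|Psi x - c|])//.
    apply: closed_bigI => c _; apply: closed_le_fun; first exact: cst_continuous.
    exact: continuous_dist.
  move=> x [_ xC] Ax; have := xC (Psi x) (imageP _ Ax).
  by rewrite subrr normr0 leNgt k0.
have trap_up : \forall e \near 0^'+, forall c, (Psi @` A) c ->
    forall h z, (forall j, 0 < h j <= e) ->
    (forall j, K (z j) -> euler_step E h z j) ->
    Psi (z 0%N) <= (c + k) + k -> forall j, Psi (z j) <= (c + k) + 2 * k.
  apply: finite_near => // _ [a Aa <-]; apply: euler_trap => //.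
    by move=> x xa; rewrite /K /=; have := Atop a Aa; move: xa k3; lra.
  move=> a' Aa'; apply/negP => /andP[a1 a2].
  have [aa'|aa'] := pselect (Psi a = Psi a'); first by move: a1 k0; rewrite aa'; lra.
  have := kgap _ (imageP _ Aa) _ (imageP _ Aa') aa'; rewrite distrC gtr0_norm; lra.
have trap_down : \forall e \near 0^'+, forall c, (Psi @` A) c ->
    forall h z, (forall j, 0 < h j <= e) ->
    (forall j, K (z j) -> euler_step E h z j) ->
    Psi (z 0%N) <= (c - 4 * k) + k -> forall j, Psi (z j) <= (c - 4 * k) + 2 * k.
  apply: finite_near => // _ [a Aa <-]; apply: euler_trap => //.
    by move=> x xa; rewrite /K /=; have := Atop a Aa; move: xa k0; lra.
  move=> a' Aa'; apply/negP => /andP[a1 a2].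
  have [aa'|aa'] := pselect (Psi a = Psi a'); first by move: a2 k0; rewrite aa'; lra.
  have := kgap _ (imageP _ Aa) _ (imageP _ Aa') aa'; rewrite gtr0_norm; lra.
have [M MP] : exists M, forall x, K x -> - M <= Psi x.
  have /compact_bounded[M [_ MP]] : compact (Psi @` K).
    by apply: continuous_compact => //; apply: continuous_subspaceT.
  exists (M + 1) => x Kx; suff : `|Psi x| <= M + 1 by rewrite ler_norml => /andP[].
  by apply: MP; [rewrite ltrDl|exact: imageP].
near=> e => h z he hoo Kz zstep.
have e0 : 0 < e by near: e; exact: nbhs_right_gt.
have ee1 : e <= e1 by near: e; exact: nbhs_right_le.
have up : forall c, (Psi @` A) c ->
    forall h z, (forall j, 0 < h j <= e) ->
    (forall j, K (z j) -> euler_step E h z j) ->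
    Psi (z 0%N) <= (c + k) + k -> forall j, Psi (z j) <= (c + k) + 2 * k by near: e.
have down : forall c, (Psi @` A) c ->
    forall h z, (forall j, 0 < h j <= e) ->
    (forall j, K (z j) -> euler_step E h z j) ->
    Psi (z 0%N) <= (c - 4 * k) + k ->
    forall j, Psi (z j) <= (c - 4 * k) + 2 * k by near: e.
have far : forall h z b, euler_chain E K e h z b -> K (z 0%N) ->
    1 <= elapsed h b <= 2 -> (forall a, A a -> r <= `|z 0%N - a|) ->
    Psi (z b) < Psi (z 0%N) - e by near: e; exact: euler_lyapunov_lt.
pose h' i j := h (i + j)%N; pose z' i j := z (i + j)%N.
have he' i j : 0 < h' i j <= e by exact: he.
have step' i j : euler_step E (h' i) (z' i) j.
  by have [v Ev zv] := zstep (i + j)%N; exists v => //; rewrite /z' addnS.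
have z'0 i : z' i 0%N = z i by rewrite /z' addn0.
have chain' i b e' : e <= e' -> euler_chain E K e' (h' i) (z' i) b.
  move=> ee' j _; have /andP[hj0 hje] := he' i j; split=> //.
    exact: le_trans ee'.
  exact: Kz.
have block i : exists b, 1 <= elapsed (h' i) b <= 2.
  have [|b] := @divergent_shift h i _ hoo 1.
    by move=> j; have /andP[] := he j.
  case/unit_time => [j|c _ c12]; last by exists c.
  have /andP[-> /le_trans] := he' i j; apply.
  exact: le_trans e11.
have near_crit i : exists2 j, (i <= j)%N &
    exists2 c, (Psi @` A) c & `|Psi (z j) - c| < k.
  apply: contrapT => nex.
  have zB j : (i <= j)%N -> B (z j).
    move=> ij; split; first exact: Kz.
    move=> c Cc; rewrite leNgt; apply/negP => zc.
    by apply: nex; exists j => //; exists c.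
  have desc m : exists2 j, (i <= j)%N & Psi (z j) <= Psi (z i) - m%:R * e.
    elim: m => [|m [j ij jm]]; first by exists i => //; rewrite mul0r subr0.
    have [b b12] := block j; exists (j + b)%N.
      exact: leq_trans ij (leq_addr _ _).
    have := far (h' j) (z' j) b (chain' _ _ _ (lexx _)); rewrite z'0.
    move=> /(_ (Kz j) b12 (fun a => rB _ a (zB j ij))); rewrite -/(z' j b).
    by move: jm; rewrite -natr1 mulrDl mul1r /z'; lra.
  pose m := Num.bound `|(Psi (z i) + M) / e|.
  have [j ij jm] := desc m; have := MP _ (Kz j).
  have : (Psi (z i) + M) / e < m%:R.
    apply: le_lt_trans (ler_norm _) _.
    exact: archi_boundP.
  by rewrite ltr_pdivrMr//; move: jm; lra.
have [c Cc cio] : exists2 c, (Psi @` A) c &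
    forall i, exists2 j, (i <= j)%N & `|Psi (z j) - c| < k.
  apply: contrapT => nex.
  have : \forall i \near \oo, forall c, (Psi @` A) c -> ~ `|Psi (z i) - c| < k.
    apply: finite_near => // c Cc; apply: contrapT => nc; apply: nex.
    exists c => // i; apply: contrapT => ni; apply: nc; exists i => // j /= ij jc.
    by apply: ni; exists j.
  move=> [i _ iP]; have [j ij [c Cc jc]] := near_crit i.
  exact: iP j ij c Cc jc.
have [i _ ic] := cio 0%N.
have below j : (i <= j)%N -> Psi (z j) <= c + 3 * k.
  move=> ij; have := up c Cc (h' i) (z' i) (he' i) (fun j _ => step' i j).
  rewrite z'0 => /(_ _ (j - i)%N); rewrite /z' subnKC// => upj.
  apply: le_trans (upj _) _; last by lra.
  by move: ic; rewrite ltr_norml; lra.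
have above j : c - 3 * k < Psi (z j).
  rewrite ltNge; apply/negP => jc; have [l jl lc] := cio j.
  have := down c Cc (h' j) (z' j) (he' j) (fun i _ => step' j i).
  rewrite z'0 => /(_ _ (l - j)%N); rewrite /z' subnKC// => dl.
  have : Psi (z l) <= c - 4 * k + 2 * k by apply: dl; move: jc; lra.
  by move: lc; rewrite ltr_norml; lra.
exists i => // j /= ij; have := below j ij; have := above j; move=> jc cj; split.
  apply: contrapT => nex; have [b b12] := block j.
  have := drop (h' j) (z' j) b (chain' _ _ _ ee1); rewrite z'0.
  move=> /(_ (Kz j) b12) => dj.
  have : Psi (z' j b) < Psi (z j) - e1.
    apply: dj => a Aa; rewrite leNgt; apply/negP => ja.
    by apply: nex; exists a.
  by have := above (j + b)%N; rewrite -/(z' j b); move: cj ke1; lra.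
case: Cc jc cj => a Aa <- jc cj; exists a => //.
by rewrite ltr_norml; move: jc cj keps; lra.
Unshelve. all: by end_near. Qed.

End Lyapunov.

(** * One pass over the components is one Euler step *)

(** With a set [phi y] of reals the statement covers both real functions and, through
    norms, set-valued maps. *)
Lemma locally_bounded_ball (R : realType) n (phi : 'rV[R]_n -> set R) :
  (forall x : 'rV[R]_n, exists M, \forall y \near x, forall t, phi y t -> t <= M) ->
  forall r, exists2 B, 0 <= B & forall y t, `|y| <= r -> phi y t -> t <= B.
Proof.
move=> phi_loc r; have cov := (compact_near_coveringP _).1 (@norm_ball_compact R n r).
have := cov R +oo (fun B y => forall t, phi y t -> t <= B) _.
case=> [x _|M [Mr MP]].
  have [M Mx] := phi_loc x; near=> y B => t /= yt.
  apply: (@le_trans _ _ M); last by near: B; apply: nbhs_pinfty_ge; exact: num_real.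
  by move: t yt; near: y.
exists (Num.max 0 (M + 1)); first by rewrite le_max lexx.
move=> y t yr yt; rewrite le_max; apply/orP; right.
by apply: (MP (M + 1)) yt => //; rewrite ltrDl.
Unshelve. all: by end_near. Qed.

Section SetValued.
Context {R : realType} {n : nat}.
Local Notation V := 'rV[R]_n.
Implicit Types (F : V -> set V).

Lemma locally_bounded_near F (x : V) : locally_bounded F ->
  exists M, \forall y \near x, forall w, F y w -> `|w| <= M.
Proof.
move=> /(_ x)[W Wx [M [_ MP]]]; exists (M + 1).
apply: filterS Wx => y Wy w Fw; apply: MP; first by rewrite ltrDl.
by exists y.
Qed.

(** The values near [x] lie in a compact ball. A point of this ball outside [F x] has
    a neighbourhood free of values [F y] for [y] near [x], and finitely many such
    neighbourhoods cover the part of the ball away from [F x]. *)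
Lemma graph_closed_usc F (x : V) (d : R) : graph_closed F -> locally_bounded F ->
  0 < d -> \forall y \near x, forall u, F y u -> exists2 w, F x w & `|u - w| <= d.
Proof.
move=> Fcl Fbd d0; have [M MP] := locally_bounded_near x Fbd.
have cov := (compact_near_coveringP _).1 (@norm_ball_compact R n M).
have near_usc : \forall y \near x, [set u | `|u| <= M] `<=`
    (fun u => F y u -> exists2 w, F x w & `|u - w| <= d).
  apply: (cov V (nbhs x)) => u _.
  have [Fxu|nFxu] := pselect (F x u).
    exists (ball u d, setT); first by split; [exact: nbhsx_ballx|exact: filterT].
    move=> [v y] [/=]; rewrite -ball_normE /= => uv _ _.
    by exists u => //; rewrite distrC ltW.
  have [[Q1 Q2] [/= Q1x Q2u] Q12] : nbhs (x, u) (~` [set xz | F xz.1 xz.2]).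
    by apply: open_nbhs_nbhs; split => //; exact: closed_openC.
  exists (Q2, Q1) => // -[v y] [/= Q2v Q1y] Fyv.
  by have := Q12 (y, v) (conj Q1y Q2v).
apply: filterS (filterI MP near_usc) => y [My Qy] u Fyu.
by apply: Qy => //=; exact: My.
Qed.

Lemma expansionP (d : R) F x u : expansion d F x u ->
  exists y w, [/\ F y w, `|y - x| <= d & `|u - w| <= d].
Proof.
move=> [y yx [w Fyw [b b0 <-]]]; exists y, w; split=> //.
  exact: le_trans (norm_le_enorm _) yx.
by rewrite addrAC subrr add0r -[b]subr0 (le_trans (norm_le_enorm _) b0).
Qed.

End SetValued.

Section Batch.
Context {R : realType} {n N : nat}.
Local Notation V := 'rV[R]_n.
Hypothesis N_gt0 : (0 < N)%N.
Variables (H : V -> set V) (U : 'I_N -> V -> set V).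
Hypothesis U_bounded : forall i, locally_bounded (U i).
Hypothesis U_closed : forall i, graph_closed (U i).
Hypothesis U_sub_H : forall x, average U x `<=` H x.

(** One pass evaluates each component at its own point [y i], displaced from the
    starting point [z] by at most [C * e], and the expansions perturb the average by
    at most [C * e]. *)
Definition batch_velocity (C : R) (e : R) (z : V) : set V :=
  [set v | exists y u : 'I_N -> V,
    (forall i, U i (y i) (u i) /\ `|y i - z| <= C * e) /\
    `|v - N%:R^-1 *: \sum_(i < N) u i| <= C * e].

Lemma norm_mean_le (u : 'I_N -> V) (d : R) :
  (forall i, `|u i| <= d) -> `|N%:R^-1 *: \sum_(i < N) u i| <= d.
Proof.
move=> ud; rewrite normrZ gtr0_norm ?invr_gt0 ?ltr0n//.
rewrite mulrC ler_pdivrMr ?ltr0n// mulrC.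
apply: le_trans (ler_norm_sum _ _ _) _; apply: le_trans (ler_sum _ (fun i _ => ud i)) _.
by rewrite sumr_const card_ord mulr_natl.
Qed.

Lemma batch_velocity_consistent (C : R) : 0 <= C -> consistent H (batch_velocity C).
Proof.
move=> C0 x d d0; have d20 : 0 < d / 2 by rewrite divr_gt0.
have /nbhs_ballP[q /= q0 qP] : \forall y \near x, forall i u, U i y u ->
    exists2 w, U i x w & `|u - w| <= d / 2.
  by apply: (filter_forall (nbhs_filter x)) => i; exact: graph_closed_usc.
have C10 : 0 < C + 1 by rewrite ltr_wpDl.
near=> y e => v [ys [us [yuP vus]]].
have e0 : 0 < e by near: e; exact: nbhs_right_gt.
have Ce1 : (C + 1) * e <= q / 2.
  by rewrite mulrC -ler_pdivlMr//; near: e; apply: nbhs_right_le; rewrite !divr_gt0.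
have Ce2 : (C + 1) * e <= d / 2.
  by rewrite mulrC -ler_pdivlMr//; near: e; apply: nbhs_right_le; rewrite !divr_gt0.
have Cle : C * e <= (C + 1) * e by rewrite ler_wpM2r ?ltW// ltrDl.
have xy : `|x - y| < q / 2.
  have : ball x (q / 2) y by near: y; apply: nbhsx_ballx; rewrite divr_gt0.
  by rewrite -ball_normE.
have /fin_all_exists2[w wU wu] : forall i, exists2 w, U i x w & `|us i - w| <= d / 2.
  move=> i; have [Uyu yz] := yuP i; apply: (qP (ys i)) => //.
  rewrite -ball_normE /= -(subrK y x) -addrA (le_lt_trans (ler_normD _ _))//.
  rewrite [ltRHS]splitr ltr_leD// distrC (le_trans yz)// (le_trans Cle)//.
exists (N%:R^-1 *: \sum_(i < N) w i); first by apply: U_sub_H; exists w.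
rewrite -(subrK (N%:R^-1 *: \sum_(i < N) us i) v) -addrA.
rewrite (le_trans (ler_normD _ _))// [leRHS]splitr lerD//.
  by rewrite (le_trans vus)// (le_trans Cle).
by rewrite -scalerBr -sumrB norm_mean_le.
Unshelve. all: by end_near. Qed.

Variables (p : V -> R) (r P B : R).
Hypothesis p_le : forall y, `|y| <= r + 1 -> p y <= P.
Hypothesis U_le : forall i y u, `|y| <= r + 1 + P -> U i y u -> `|u| <= B.
Hypothesis P_ge0 : 0 <= P.
Hypothesis B_ge0 : 0 <= B.

(** As long as the pass stays within distance [1] of its starting point, the
    components and [p] are bounded by [B] and [P], so each inner step moves by at
    most [(B + P) * eta]; for small [eta] the pass cannot leave that region. *)
Lemma batch_step (eta : R) (i : nat -> 'I_N) (x : nat -> V) :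
  0 < eta -> eta <= 1 -> N%:R * (B + P) * eta <= 1 ->
  (forall a, exists2 l, (l < N)%N & i l = a) -> `|x 0%N| <= r ->
  (forall l, (l < N)%N -> exists2 u, expansion (p (x l) * eta) (U (i l)) (x l) u &
    x l.+1 = x l - eta *: u) ->
  (forall l, (l <= N)%N -> `|x l - x 0%N| <= N%:R * (B + P) * eta) /\
  exists2 v, batch_velocity (N%:R * (B + P) + P) (N%:R * eta) (x 0%N) v &
    x N = x 0%N - (N%:R * eta) *: v.
Proof.
move=> eta0 eta1 BPeta i_surj x0r xstep.
have BP0 : 0 <= B + P by rewrite addr_ge0.
have near0 l : (l <= N)%N -> l%:R * (B + P) * eta <= N%:R * (B + P) * eta.
  by move=> lN; rewrite !ler_wpM2r ?(ltW eta0)// ler_nat.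
have pieces l : (l < N)%N -> `|x l - x 0%N| <= l%:R * (B + P) * eta ->
    exists y w u, [/\ U (i l) y w, `|y - x l| <= P * eta, `|u - w| <= P * eta,
      `|u| <= B + P & x l.+1 = x l - eta *: u].
  move=> lN xl; have [u /expansionP[y [w [Uyw yx uw]]] xS] := xstep l lN.
  have xlr : `|x l| <= r + 1.
    rewrite -(subrK (x 0%N) (x l)) (le_trans (ler_normD _ _))// addrC lerD//.
    by rewrite (le_trans xl)// (le_trans (near0 l (ltnW lN))).
  have pP : p (x l) * eta <= P * eta by rewrite ler_wpM2r ?(ltW eta0)// p_le.
  have PetaP : P * eta <= P by rewrite ler_piMr.
  have uw' := le_trans uw pP; have yx' := le_trans yx pP.
  exists y, w, u; split=> //.
  rewrite -(subrK w u) (le_trans (ler_normD _ _))// addrC lerD//.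
    apply: U_le Uyw; rewrite -(subrK (x l) y) (le_trans (ler_normD _ _))// addrC lerD//.
    exact: le_trans PetaP.
  exact: le_trans PetaP.
have xl l : (l <= N)%N -> `|x l - x 0%N| <= l%:R * (B + P) * eta.
  elim: l => [|l IH] lN; first by rewrite subrr normr0 !mul0r.
  have [y [w [u [_ _ _ uB ->]]]] := pieces l lN (IH (ltnW lN)).
  have -> : l.+1%:R * (B + P) * eta = l%:R * (B + P) * eta + (B + P) * eta.
    by rewrite -natr1; ring.
  rewrite addrAC (le_trans (ler_normB _ _))// lerD ?IH 1?ltnW//.
  by rewrite normrZ gtr0_norm// mulrC ler_wpM2r// ltW.
split=> [l lN|]; first exact: le_trans (xl l lN) (near0 l lN).
have /fin_all_exists[f fP] : forall l : 'I_N, exists ywu : V * V * V,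
   [/\ U (i l) ywu.1.1 ywu.1.2, `|ywu.1.1 - x l| <= P * eta,
     `|ywu.2 - ywu.1.2| <= P * eta & x l.+1 = x l - eta *: ywu.2].
  move=> l; have lN := ltn_ord l.
  have [y [w [u [Uyw yx uw _ xS]]]] := pieces l lN (xl l (ltnW lN)).
  by exists (y, w, u).
(* [g] tells when a component is visited. It is a permutation, hence the sum over
   visits is a sum over components. *)
have /fin_all_exists[g gP] : forall a, exists l : 'I_N, i l = a.
  by move=> a; have [l lN la] := i_surj a; exists (Ordinal lN).
have g_inj : injective g by move=> a b gab; rewrite -(gP a) gab gP.
have xN : x N = x 0%N - eta *: \sum_(l < N) (f l).2.
  have main m (mN : (m <= N)%N) :
      x m = x 0%N - eta *: \sum_(l < m) (f (widen_ord mN l)).2.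
    elim: m mN => [|m IH] mN; first by rewrite big_ord0 scaler0 subr0.
    have [_ _ _] := fP (Ordinal mN); rewrite /= (IH (ltnW mN)) => ->.
    rewrite big_ord_recr /= scalerDr opprD addrA; congr (_ - _ - _ *: (f _).2).
      by congr (_ *: _); apply: eq_bigr => l _; congr (f _).2; exact: val_inj.
    exact: val_inj.
  rewrite (main N (leqnn N)); congr (_ - _ *: _).
  by apply: eq_bigr => l _; congr (f _).2; exact: val_inj.
have N0 : 0 < N%:R :> R by rewrite ltr0n.
have etaN : eta <= N%:R * eta by rewrite ler_peMl ?(ltW eta0)// ler1n.
have PN : P * eta <= (N%:R * (B + P) + P) * (N%:R * eta).
  apply: le_trans (_ : P * (N%:R * eta) <= _); first by rewrite ler_wpM2l.
  by rewrite ler_wpM2r ?mulr_ge0 ?(ltW eta0)// lerDr mulr_ge0.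
exists (N%:R^-1 *: \sum_(l < N) (f l).2); last first.
  by rewrite xN scalerA mulrAC divff ?mul1r// gt_eqF.
exists (fun a => (f (g a)).1.1), (fun a => (f (g a)).1.2); split=> [a|].
  have [Uyw yx _ _] := fP (g a); rewrite gP in Uyw; split=> //.
  rewrite -(subrK (x (g a)) (f (g a)).1.1) -addrA (le_trans (ler_normD _ _))//.
  have := xl _ (ltnW (ltn_ord (g a))).
  move=> /le_trans/(_ (near0 _ (ltnW (ltn_ord (g a)))))=> xg.
  apply: le_trans (lerD yx xg) _.
  rewrite -mulrDl addrC ler_wpM2l// addr_ge0// mulr_ge0//.
rewrite -scalerBr (reindex_inj g_inj)/= -sumrB.
by apply: norm_mean_le => a; have [_ _ uw _] := fP (g a); exact: le_trans PN.
Qed.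

End Batch.

(** * Upper limits and divergent series *)

Section Limits.
Context {R : realType}.

Lemma limn_esup_le_near (u : nat -> \bar R) (a : \bar R) :
  (\forall k \near \oo, (u k <= a)%E) -> (limn_esup u <= a)%E.
Proof.
move=> ua; rewrite /limn_esup limf_esupE.
apply: (@le_trans _ _ (ereal_sup [set u x | x in [set k | (u k <= a)%E]])).
  by apply: ereal_inf_lbound; exists [set k | (u k <= a)%E].
by apply: ge_ereal_sup => _ [k /= ka <-].
Qed.

Lemma limn_esup_lt_near (u : nat -> \bar R) (a : \bar R) :
  (limn_esup u < a)%E -> \forall k \near \oo, (u k <= a)%E.
Proof.
rewrite /limn_esup limf_esupE => /ereal_inf_lt[_ [W Woo <-]] supW.
apply: filterS Woo => k Wk; apply: le_trans (ltW supW).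
by apply: ereal_sup_ubound; exists k.
Qed.

Lemma divergent_series (eta : nat -> R) : (forall k, 0 < eta k) ->
  (\sum_(0 <= k <oo) (eta k)%:E = +oo)%E -> divergent eta.
Proof.
move=> eta0 etaoo M; apply: contrapT => nM.
have etaM b : elapsed eta b <= M.
  by rewrite leNgt; apply/negP => Mb; apply: nM; exists b; exact: ltW.
suff : (\sum_(0 <= k <oo) (eta k)%:E <= M%:E)%E by rewrite etaoo leye_eq.
apply: lime_le; first by apply: is_cvg_nneseries => k _ _; rewrite lee_fin ltW.
by apply: nearW => b; rewrite sumEFin lee_fin big_mkord; exact: etaM.
Qed.

Lemma elapsed_blocks (eta : nat -> R) N b : (0 < N)%N ->
  (forall j1 j2 : nat, (j1 %/ N = j2 %/ N)%N -> eta j1 = eta j2) ->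
  elapsed (fun j => N%:R * eta (j * N)%N) b = elapsed eta (b * N).
Proof.
move=> N0 etaN; elim: b => [|b IH]; first by rewrite mul0n !elapsed0.
rewrite elapsedS IH mulSn addnC -[RHS](subrK (elapsed eta (b * N))).
rewrite -elapsed_shift addrC; congr (_ + _).
rewrite /elapsed (eq_bigr (fun=> eta (b * N)%N)).
  by rewrite sumr_const card_ord mulr_natl.
by move=> l _; apply: etaN; rewrite divnMDl// divn_small// addn0 mulnK.
Qed.

Lemma compact_uniform_continuity n (f : 'rV[R]_n -> R) (K : set 'rV[R]_n) (d : R) :
  compact K -> continuous f -> 0 < d ->
  \forall e \near 0^'+, forall z x, K z -> `|x - z| <= e -> `|f x - f z| <= d.
Proof.
move=> Kc fc d0; have d20 : 0 < d / 2 by rewrite divr_gt0.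
have cov := (compact_near_coveringP _).1 Kc.
have : \forall e \near 0^'+, K `<=`
    (fun z => forall x, `|x - z| <= e -> `|f x - f z| <= d).
  apply: (cov R (0^'+)) => z Kz.
  have /nbhs_ballP[q /= q0 qP] : nbhs z (f @^-1` (ball (f z) (d / 2))).
    by apply: fc; exact: nbhsx_ballx.
  exists (ball z (q / 2), [set e | e < q / 2]).
    split=> /=; first by apply: nbhsx_ballx; rewrite divr_gt0.
    by apply: nbhs_right_lt; rewrite divr_gt0.
  move=> [y e] [/= yz eq] x xy.
  have zq w : `|z - w| < q -> `|f z - f w| < d / 2.
    move=> zw; have : ball z q w by rewrite -ball_normE.
    by move/qP => /=; rewrite -ball_normE.
  move: yz; rewrite -ball_normE /= => zy.
  have zy' : `|z - y| < q by rewrite (lt_trans zy)// ltr_pdivrMr// ltr_pMr// ltr1n.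
  have zx : `|z - x| < q.
    rewrite -(subrK y z) -addrA (le_lt_trans (ler_normD _ _))//.
    by rewrite [ltRHS]splitr ltrD// distrC (le_lt_trans xy).
  have := zq _ zy'; have := zq _ zx => fx fy.
  rewrite -(subrK (f z) (f x)) -addrA (le_trans (ler_normD _ _))//.
  by rewrite [leRHS]splitr lerD ?ltW// distrC.
by apply: filterS => e eP z x Kz; exact: eP.
Qed.

End Limits.

(** * Convergence of the iterates *)

Theorem theorem3p11 (R : realType) (n N : nat) (N_gt0 : (0 < N)%N)
  (H : 'rV[R]_n -> set 'rV[R]_n)
  (H_nonempty : forall x, H x !=set0)
  (H_convex : forall x, @convex_set R 'rV[R]_n (H x))
  (H_closed : graph_closed H)
  (H_bounded : locally_bounded H)
  (A : set 'rV[R]_n) (A_closed : closed A)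
  (Psi : 'rV[R]_n -> R)
  (Psi_coercive : coercive Psi)
  (Psi_lipschitz : locally_lipschitz Psi)
  (Psi_lyapunov : lyapunov (fun x => conv_hull (H x)) Psi A)
  (H_solvable : solvable_everywhere (fun x => conv_hull (H x)))
  (Psi_A_finite : finite_set (Psi @` A))
  (U : 'I_N -> 'rV[R]_n -> set 'rV[R]_n)
  (U_bounded : forall i, locally_bounded (U i))
  (U_closed : forall i, graph_closed (U i))
  (U_sub_H : forall x, conv_hull (average U x) `<=` H x)
  (p : 'rV[R]_n -> R) (p_ge0 : forall x, 0 <= p x)
  (p_bounded : fun_locally_bounded p)
  (X0 : set 'rV[R]_n) (X0_compact : compact X0) :
  exists2 alpha_ub : R, 0 < alpha_ub &
  forall eps : R, 0 < eps ->
  exists2 alpha : R, 0 < alpha &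
  forall eta : nat -> R,
    (forall k, 0 < eta k) ->
    (\sum_(0 <= k <oo) (eta k)%:E = +oo)%E ->
    (forall j1 j2 : nat, (j1 %/ N = j2 %/ N)%N -> eta j1 = eta j2) ->
    (forall k, eta k <= alpha_ub) ->
    (limn_esup (fun k => (eta k)%:E) <= alpha%:E)%E ->
  forall i : nat -> 'I_N,
    (forall j : nat,
      i @` [set k | (j * N <= k < j.+1 * N)%N] = [set: 'I_N]) ->
  forall x : nat -> 'rV[R]_n,
    X0 (x 0%N) ->
    (forall k, exists2 u,
      expansion (p (x k) * eta k) (U (i k)) (x k) u &
      x k.+1 = x k - eta k *: u) ->
  (limn_esup (fun k => edist_to (x k) A) <= eps%:E)%E /\
  (limn_esup (fun k => edist_inf (Psi @` A) (Psi (x k))) <= eps%:E)%E.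
Proof.
have HE : (fun x => conv_hull (H x)) = H.
  by apply/funext => x; exact: conv_hull_id.
rewrite HE in Psi_lyapunov H_solvable.
have Psi_cont : continuous Psi by case: Psi_lyapunov.
have avg_sub x : average U x `<=` H x.
  by apply: subset_trans (U_sub_H x); exact: sub_smallest.
have [l [lA lX0]] : exists l, (forall a, A a -> Psi a < l) /\
    (forall x, X0 x -> Psi x <= l + 1).
  have /compact_bounded[M [_ MP]] : compact (Psi @` X0).
    by apply: continuous_compact => //; apply: continuous_subspaceT.
  have : \forall l \near +oo, forall c, (Psi @` A) c -> c < l.
    by apply: finite_near => // c _; exact: nbhs_pinfty_gt (num_real c).
  move=> Al.
  have [l [lA lM]] := filter_ex (filterI Al (nbhs_pinfty_ge (num_real (M + 1)))).
  exists l; split=> [a Aa|x X0x]; first exact: lA (imageP _ Aa).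
  apply: le_trans (ler_norm _) _; apply: (MP (l + 1)); last exact: imageP.
  by move: lM; lra.
(* The band [[l, l + 1]] contains no critical value, and [X0] lies below its top. *)
pose top := l + 2.
have [r0 r0P] := Psi_coercive (top + 1); pose r := `|r0|.
have Kr x : Psi x <= top -> `|x| <= r.
  move=> xtop; rewrite leNgt; apply/negP => rx.
  have : top + 1 <= Psi x.
    apply: r0P; rewrite (le_trans (ler_norm _))// (le_trans (ltW rx))//.
    exact: norm_le_enorm.
  by move: xtop; lra.
have K_compact : compact [set x | Psi x <= top].
  apply: subclosed_compact (@norm_ball_compact R n r) _ => //.
  by apply: closed_le_fun => //; exact: cst_continuous.
have [P P0 p_le] : exists2 P, 0 <= P & forall y, `|y| <= r + 1 -> p y <= P.
  have [x|P P0 PP] := @locally_bounded_ball R n (fun y => [set p y]) _ (r + 1).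
    have [W Wx [M [_ MP]]] := p_bounded x; exists (M + 1).
    apply: filterS Wx => y Wy _ ->; apply: le_trans (ler_norm _) _.
    by apply: (MP (M + 1)); [rewrite ltrDl|exact: imageP].
  by exists P => // y yr; exact: PP yr _.
have [B B0 U_le] : exists2 B, 0 <= B & forall i y u,
    `|y| <= r + 1 + P -> U i y u -> `|u| <= B.
  have /fin_all_exists2[B B0 BP] : forall i, exists2 B, 0 <= B & forall y t,
      `|y| <= r + 1 + P -> [set `|u| | u in U i y] t -> t <= B.
    move=> i; apply: locally_bounded_ball => x.
    have [M MP] := locally_bounded_near x (U_bounded i); exists M.
    by apply: filterS MP => y My _ [u Uu <-]; exact: My.
  exists (\sum_i B i); first exact: sumr_ge0.
  move=> i y u yr Uu; apply: le_trans (BP i y _ yr _) _; first by exists u.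
  by rewrite (bigD1 i)//= lerDl sumr_ge0.
pose C := N%:R * (B + P) + P.
have C0 : 0 <= C by rewrite addr_ge0// mulr_ge0// addr_ge0.
pose E := batch_velocity U C.
have E_cons : consistent H E by exact: batch_velocity_consistent.
have N0 : 0 < N%:R :> R by rewrite ltr0n.
have [e1 e10 trap] : exists2 e1, 0 < e1 & forall h z, (forall j, 0 < h j <= e1) ->
    (forall j, Psi (z j) <= top -> euler_step E h z j) ->
    Psi (z 0%N) <= l + 1 -> forall j, Psi (z j) <= top.
  have topE : top = l + 2 * 1 by rewrite mulr1.
  have sub_top y : Psi y <= l + 2 * 1 -> [set y | Psi y <= top] y by rewrite topE.
  have lA' a : A a -> ~~ (l <= Psi a <= l + 1) by move=> /lA al; rewrite leNgt al.
  have trap := euler_trap H_nonempty H_convex H_closed H_bounded H_solvable E_cons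
    Psi_lyapunov K_compact ltr01 sub_top lA'.
  rewrite -topE in trap.
  near (0 : R)^'+ => e1; exists e1; first by near: e1; exact: nbhs_right_gt.
  by near: e1.
pose D := N%:R * (B + P); have D0 : 0 <= D by rewrite mulr_ge0// addr_ge0.
(* Passes with [eta <= e1 / N] are steps [N * eta <= e1], to which [trap] applies;
   the other two bounds are what [batch_step] requires. *)
exists (Num.min (e1 / N%:R) (Num.min 1 (D + 1)^-1)).
  by rewrite !lt_min divr_gt0//= ltr01 invr_gt0 ltr_wpDl.
(* Half of [eps] pays for the distance between [x k] and the start of its pass; the
   factor [n.+1] for the comparison of the two norms. *)
move=> eps eps0; pose eps1 := eps / (2 * n.+1%:R).
have eps10 : 0 < eps1 by rewrite divr_gt0// mulr_gt0.
have asym : \forall e \near 0^'+, forall h z,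
    (forall j, 0 < h j <= e) -> divergent h ->
    (forall j, Psi (z j) <= top) -> (forall j, euler_step E h z j) ->
    \forall j \near \oo, (exists2 a, A a & `|z j - a| < eps1) /\
                         (exists2 a, A a & `|Psi (z j) - Psi a| < eps1).
  apply: (euler_asymptotics H_nonempty H_convex H_closed H_bounded
    H_solvable E_cons Psi_lyapunov K_compact) => //.
  by move=> a /lA; rewrite /top; lra.
have [e2 [e20 {}asym ucont e2eps]] : exists e2, [/\ 0 < e2, forall h z,
    (forall j, 0 < h j <= e2) -> divergent h ->
    (forall j, Psi (z j) <= top) -> (forall j, euler_step E h z j) ->
    \forall j \near \oo, (exists2 a, A a & `|z j - a| < eps1) /\
                         (exists2 a, A a & `|Psi (z j) - Psi a| < eps1),
    forall z x, Psi z <= top -> `|x - z| <= e2 -> `|Psi x - Psi z| <= eps1 &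
    e2 <= eps1].
  near (0 : R)^'+ => e2; exists e2; split.
  - by near: e2; exact: nbhs_right_gt.
  - by near: e2; exact: asym.
  - by near: e2; exact: (@compact_uniform_continuity _ _ _ [set x | Psi x <= top]).
  - by near: e2; exact: nbhs_right_le.
pose alpha := Num.min (e2 / N%:R) (e2 / (D + 1)).
have alpha0 : 0 < alpha by rewrite lt_min !divr_gt0// ltr_wpDl.
(* The upper limit being strictly below [alpha], eventually [eta k <= alpha]. *)
exists (alpha / 2); first by rewrite divr_gt0.
move=> eta eta0 eta_oo eta_block eta_ub eta_lim i i_surj x x0 xstep.
pose z j := x (j * N)%N; pose h j := N%:R * eta (j * N)%N.
have h0 j : 0 < h j by rewrite mulr_gt0.
have eta_in j k : (k < N)%N -> eta (j * N + k)%N = eta (j * N)%N.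
  by move=> kN; apply: eta_block; rewrite divnMDl// divn_small// addn0 mulnK.
have batch j : Psi (z j) <= top ->
    (forall k, (k <= N)%N -> `|x (j * N + k)%N - z j| <= D * eta (j * N)%N) /\
    euler_step E h z j.
  move=> zK; have /andP[_ /andP[eta1 etaD]] :
      (eta (j * N)%N <= e1 / N%:R) &&
      ((eta (j * N)%N <= 1) && (eta (j * N)%N <= (D + 1)^-1)).
    by rewrite -!le_min.
  have [|||k kN|near_z [v Ev xv]] := @batch_step R n N N_gt0 U p r P B p_le U_le P0 B0
     (eta (j * N)%N) (fun k => i (j * N + k)%N) (fun k => x (j * N + k)%N) (eta0 _) eta1.
  - rewrite -/D (le_trans (_ : _ <= D * (D + 1)^-1)) ?ler_wpM2l//.
    by rewrite ler_pdivrMr ?ltr_wpDl// mul1r lerDl.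
  - move=> a; have [k /= /andP[jk kj] <-] :
        (i @` [set k | (j * N <= k < j.+1 * N)%N]) a.
      by rewrite i_surj.
    exists (k - j * N)%N; last by rewrite subnKC.
    by rewrite ltn_subLR// -mulSnr.
  - by rewrite addn0; exact: Kr.
  - have [u] := xstep (j * N + k)%N; rewrite eta_in// => uE xu.
    by exists u => //; rewrite addnS.
  move: near_z xv; rewrite addn0 => near_z xv; split=> //.
  by exists v; [rewrite addn0 in Ev|rewrite /z mulSnr].
have zK : forall j, Psi (z j) <= top.
  apply: (trap h) => [j|j /batch[]//|]; last by rewrite /z mul0n; exact: lX0.
  rewrite h0 /= /h mulrC -ler_pdivlMr//.
  by apply: le_trans (eta_ub _) _; rewrite ge_min lexx.
have h_div : divergent h.
  move=> M; have [b bM] := divergent_series eta0 eta_oo M; exists b.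
  rewrite elapsed_blocks// (le_trans bM)// (@elapsed_homo _ _ (b * N))//.
  by rewrite leq_pmulr.
have [J _ etaJ] : \forall k \near \oo, eta k <= alpha.
  have /limn_esup_lt_near : (limn_esup (fun k => (eta k)%:E) < alpha%:E)%E.
    apply: le_lt_trans eta_lim _; rewrite lte_fin ltr_pdivrMr// ltr_pMr// ltr1n.
    by [].
  by apply: filterS => k; rewrite lee_fin.
have etaJN j : (J <= j)%N -> eta (j * N)%N <= alpha.
  by move=> Jj; apply: etaJ; rewrite /= (leq_trans Jj)// leq_pmulr.
have [||j0 _ j0P] := asym (fun j => h (J + j)%N) (fun j => z (J + j)%N) _
  (divergent_shift J h0 h_div) (fun j => zK _) _.
- move=> j; rewrite h0 /= /h mulrC -ler_pdivlMr//.
  by apply: le_trans (etaJN _ (leq_addr _ _)) _; rewrite ge_min lexx.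
- move=> j; have [_ [v Ev zv]] := batch _ (zK (J + j)%N).
  by exists v; rewrite // addnS.
have late : \forall k \near \oo, (exists2 a, A a & enorm (x k - a) <= eps) /\
    (exists2 a, A a & `|Psi (x k) - Psi a| <= eps).
  exists ((J + j0) * N)%N => // k /= kN; pose j := (k %/ N)%N.
  have Jj : (J + j0 <= j)%N by rewrite leq_divRL.
  have xz : `|x k - z j| <= e2.
    have [+ _] := batch j (zK j) => /(_ (k %% N)%N (ltnW (ltn_pmod _ N_gt0))).
    rewrite -divn_eq => /le_trans; apply.
    apply: (@le_trans _ _ ((D + 1) * alpha)).
      rewrite ler_pM// ?(ltW (eta0 _)) ?lerDl//.
      by apply: etaJN; exact: leq_trans (leq_addr _ _) Jj.
    by rewrite mulrC -ler_pdivlMr ?ltr_wpDl// ge_min lexx orbT.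
  have [] := j0P (j - J)%N; first by rewrite /= leq_subRL// (leq_trans _ Jj)// leq_addr.
  rewrite subnKC ?(leq_trans _ Jj) ?leq_addr// => -[a Aa za] [c Ac zc].
  split.
    exists a => //; apply: le_trans (enorm_le_norm _) _.
    have xa : `|x k - a| <= 2 * eps1.
      rewrite -(subrK (z j) (x k)) -addrA (le_trans (ler_normD _ _))//.
      by move: za xz e2eps; lra.
    apply: (@le_trans _ _ (n.+1%:R * (2 * eps1))).
      by rewrite ler_pM// ler_nat.
    rewrite [leLHS](_ : _ = eps1 * (2 * n.+1%:R)); last by ring.
    by rewrite /eps1 divfK// gt_eqF// mulr_gt0.
  exists c => //; rewrite -(subrK (Psi (z j)) (Psi (x k))) -addrA.
  apply: le_trans (ler_normD _ _) _.
  have : 2 * eps1 <= eps.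
    rewrite /eps1 mulrC -ler_pdivlMr// ler_pM2l// lef_pV2 ?posrE ?mulr_gt0//.
    by rewrite ler_peMr// ler1n.
  by have := ucont _ _ (zK j) xz; move: zc; lra.
split; apply: limn_esup_le_near; apply: filterS late => k [[a Aa xa] [c Ac xc]].
  apply: le_trans (ereal_inf_lbound _) _; first by exists a.
  by rewrite lee_fin.
apply: (@le_trans _ _ (edist (Psi (x k), Psi c))).
  by apply: ereal_inf_lbound; exists (Psi c) => //; exact: imageP.
apply/lee_addgt0Pr => d d0; rewrite -EFinD; apply: edist_fin.
  by rewrite addr_gt0.
by rewrite -ball_normE /=; move: xc d0; lra.
Unshelve. all: by end_near. Qed.
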